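(* Let $\mathcal{C},\mathcal{D}$ be 2-categories, let $\mathcal{A}$ be either $\mathcal{H}om(\mathcal{C},\mathcal{D})$ or $\mathcal{H}om_p(\mathcal{C},\mathcal{D})$, and let $F:\mathcal{I}\to\mathcal{A}$, $i\mapsto F_i$, be a pseudo-functor from a 2-category $\mathcal{I}$. For each object $C\in\mathcal{C}$ let $\lambda^C_i:F_iC\to LC$ be a pseudo-colimit pseudo-cone in $\mathcal{D}$ for the pseudo-functor $\mathcal{I}\xrightarrow{F}\mathcal{A}\xrightarrow{ev(-,C)}\mathcal{D}$, where $ev(-,C)$ is evaluation at $C$. Then $LC$ is 2-functorial in $C$ in such a way that $\lambda_i$ becomes 2-natural and $\lambda_i:F_i\to L$ is a pseudo-colimit pseudo-cone in $\mathcal{A}$, in both cases. By duality the same assertion holds for pseudo-limits.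
   Context: $\mathcal{H}om(\mathcal{C},\mathcal{D})$ (respectively $\mathcal{H}om_p(\mathcal{C},\mathcal{D})$) is the 2-category of 2-functors $\mathcal{C}\to\mathcal{D}$, 2-natural (respectively pseudo-natural) transformations and modifications. A pseudo-cone for a pseudo-functor $F:\mathcal{I}\to\mathcal{B}$ with vertex $B$ is a pseudo-natural transformation from $F$ to the constant 2-functor at $B$; morphisms of pseudo-cones are modifications. A pseudo-colimit pseudo-cone $\lambda$ with vertex $L$ is one such that for each $B$, pre-composition with $\lambda$ is an isomorphism of categories from $\mathcal{B}(L,B)$ to the category of pseudo-cones for $F$ with vertex $B$. Pseudo-limits are defined dually. *)

(* Defs.v *)
From Stdlib Require Import FunctionalExtensionality ProofIrrelevance.
From Stdlib Require Import ssreflect.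

Set Implicit Arguments.
Unset Strict Implicit.
Unset Printing Implicit Defensive.
Local Obligation Tactic := cbn; intros.

Declare Scope cat_scope.
Delimit Scope cat_scope with cat.
Open Scope cat_scope.

Reserved Notation "g • f" (at level 50, left associativity).
Reserved Notation "g ∘ f" (at level 40, left associativity).
Reserved Notation "b ∗ a" (at level 40, left associativity).
Reserved Notation "g ◁ a" (at level 40, left associativity).
Reserved Notation "a ▷ f" (at level 40, left associativity).

Record Category := {
  obj :> Type;
  mor : obj -> obj -> Type;
  idm : forall x, mor x x;
  compm : forall x y z, mor y z -> mor x y -> mor x z;
  compm1l : forall x y (f : mor x y), compm (idm y) f = f;
  compm1r : forall x y (f : mor x y), compm f (idm x) = f;
  compmA : forall x y z w (h : mor z w) (g : mor y z) (f : mor x y),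
    compm h (compm g f) = compm (compm h g) f
}.
Arguments idm {_} x.
Arguments compm {_ x y z} g f.
Notation "g • f" := (compm g f) : cat_scope.

Definition is_iso (C : Category) (x y : C) (f : mor x y) : Prop :=
  exists g : mor y x, g • f = idm x /\ f • g = idm y.

(* The identity of [x], regarded as a morphism [x -> y] along [x = y]. *)
Definition eqm (C : Category) (x y : C) (e : x = y) : mor x y :=
  match e with eq_refl => idm x end.

Record Functor (C D : Category) := {
  fobj :> C -> D;
  fmor : forall x y, mor x y -> mor (fobj x) (fobj y);
  fmor_id : forall x, fmor (idm x) = idm (fobj x);
  fmor_comp : forall x y z (g : mor y z) (f : mor x y),
    fmor (g • f) = fmor g • fmor f
}.
Arguments fmor {C D} _ {x y} f.

Definition id_functor (C : Category) : Functor C C :=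
  {| fobj := fun x => x; fmor := fun _ _ f => f;
     fmor_id := fun _ => eq_refl; fmor_comp := fun _ _ _ _ _ => eq_refl |}.

Program Definition comp_functor (C D E : Category)
    (G : Functor D E) (F : Functor C D) : Functor C E :=
  {| fobj := fun x => G (F x); fmor := fun _ _ f => fmor G (fmor F f) |}.
Next Obligation. by rewrite !fmor_id. Qed.
Next Obligation. by rewrite !fmor_comp. Qed.

Definition is_cat_isomorphism (C D : Category) (F : Functor C D) : Prop :=
  exists G : Functor D C,
    comp_functor G F = id_functor C /\ comp_functor F G = id_functor D.

Program Definition full_subcategory (C : Category) (P : C -> Prop) : Category :=
  {| obj := {x : C | P x};
     mor := fun x y => mor (proj1_sig x) (proj1_sig y);
     idm := fun x => idm (proj1_sig x);
     compm := fun _ _ _ g f => g • f |}.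
Next Obligation. exact: compm1l. Qed.
Next Obligation. exact: compm1r. Qed.
Next Obligation. exact: compmA. Qed.

Lemma eqm_irr (C : Category) (x y : C) (p q : x = y) : eqm p = eqm q.
Proof. by rewrite (proof_irrelevance _ p q). Qed.

Lemma eqm1 (C : Category) (x : C) (p : x = x) : eqm p = idm x.
Proof. exact: (eqm_irr p eq_refl). Qed.

Lemma eqm_comp (C : Category) (x y z : C) (p : x = y) (q : y = z) :
  eqm q • eqm p = eqm (eq_trans p q).
Proof. by case: z / q; rewrite /= compm1l. Qed.

Lemma eqm_compA (C : Category) (x y z w : C) (p : x = y) (q : y = z) (a : mor w x) :
  eqm q • (eqm p • a) = eqm (eq_trans p q) • a.
Proof. by rewrite compmA eqm_comp. Qed.

Lemma eqm_iso (C : Category) (x y : C) (p : x = y) : is_iso (eqm p).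
Proof. by case: y / p; exists (idm x); rewrite /= compm1l. Qed.

Lemma fmor_eqm (C D : Category) (F : Functor C D) (x y : C) (p : x = y) :
  fmor F (eqm p) = eqm (f_equal F p).
Proof. by case: y / p; rewrite /= fmor_id. Qed.

Lemma is_iso_comp (C : Category) (x y z : C) (g : mor y z) (f : mor x y) :
  is_iso g -> is_iso f -> is_iso (g • f).
Proof.
move=> [g' [g1 g2]] [f' [f1 f2]]; exists (f' • g'); split.
- by rewrite -compmA (compmA g') g1 compm1l.
- by rewrite -compmA (compmA f) f2 compm1l.
Qed.

Lemma is_iso_fmor (C D : Category) (F : Functor C D) (x y : C) (f : mor x y) :
  is_iso f -> is_iso (fmor F f).
Proof.
by move=> [g [g1 g2]]; exists (fmor F g); rewrite -!fmor_comp g1 g2 !fmor_id.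
Qed.

(* Strict 2-categories.  The associativity and unit laws hold as equalities of
   1-cells; the corresponding laws for 2-cells are typed along these equalities
   by means of [eqm]. *)
Record TwoCat := {
  ob :> Type;
  hom : ob -> ob -> Category;
  id1 : forall x, hom x x;
  comp1 : forall x y z, hom y z -> hom x y -> hom x z;
  hcomp : forall x y z (g g' : hom y z) (f f' : hom x y),
    mor g g' -> mor f f' -> mor (comp1 g f) (comp1 g' f');
  hcomp_id : forall x y z (g : hom y z) (f : hom x y),
    hcomp (idm g) (idm f) = idm (comp1 g f);
  hcomp_comp : forall x y z (g g' g'' : hom y z) (f f' f'' : hom x y)
      (b' : mor g' g'') (b : mor g g') (a' : mor f' f'') (a : mor f f'),
    hcomp (b' • b) (a' • a) = hcomp b' a' • hcomp b a;
  comp1A : forall x y z w (h : hom z w) (g : hom y z) (f : hom x y),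
    comp1 h (comp1 g f) = comp1 (comp1 h g) f;
  comp1l : forall x y (f : hom x y), comp1 (id1 y) f = f;
  comp1r : forall x y (f : hom x y), comp1 f (id1 x) = f;
  hcompA : forall x y z w (h h' : hom z w) (g g' : hom y z) (f f' : hom x y)
      (c : mor h h') (b : mor g g') (a : mor f f'),
    eqm (comp1A h' g' f') • hcomp c (hcomp b a)
    = hcomp (hcomp c b) a • eqm (comp1A h g f);
  hcomp1l : forall x y (f f' : hom x y) (a : mor f f'),
    eqm (comp1l f') • hcomp (idm (id1 y)) a = a • eqm (comp1l f);
  hcomp1r : forall x y (f f' : hom x y) (a : mor f f'),
    eqm (comp1r f') • hcomp a (idm (id1 x)) = a • eqm (comp1r f)
}.
Arguments hom {_} x y.
Arguments id1 {_} x.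
Arguments comp1 {_ x y z} g f.
Arguments hcomp {_ x y z g g' f f'} b a.
Notation "g ∘ f" := (comp1 g f) : cat_scope.
Notation "b ∗ a" := (hcomp b a) : cat_scope.
Notation "g ◁ a" := (hcomp (idm g) a) : cat_scope.
Notation "a ▷ f" := (hcomp a (idm f)) : cat_scope.

Section Whiskering.
Context {B : TwoCat}.

Lemma lw_comp (x y z : B) (g : hom y z) (f f' f'' : hom x y)
    (a' : mor f' f'') (a : mor f f') : g ◁ (a' • a) = (g ◁ a') • (g ◁ a).
Proof. by rewrite -hcomp_comp compm1l. Qed.

Lemma rw_comp (x y z : B) (g g' g'' : hom y z) (f : hom x y)
    (b' : mor g' g'') (b : mor g g') : (b' • b) ▷ f = (b' ▷ f) • (b ▷ f).
Proof. by rewrite -hcomp_comp compm1l. Qed.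

Lemma hcomp_lr (x y z : B) (g g' : hom y z) (f f' : hom x y)
    (b : mor g g') (a : mor f f') : b ∗ a = (g' ◁ a) • (b ▷ f).
Proof. by rewrite -hcomp_comp compm1l compm1r. Qed.

Lemma exchange (x y z : B) (g g' : hom y z) (f f' : hom x y)
    (b : mor g g') (a : mor f f') : (b ▷ f') • (g ◁ a) = (g' ◁ a) • (b ▷ f).
Proof. by rewrite -!hcomp_comp !compm1l !compm1r. Qed.

Lemma hcomp_eqm (x y z : B) (g g' : hom y z) (f f' : hom x y)
    (p : g = g') (q : f = f') :
  eqm p ∗ eqm q = eqm (f_equal2 comp1 p q).
Proof. by case: g' / p; case: f' / q; rewrite /= hcomp_id eqm1. Qed.

Lemma lw_eqm (x y z : B) (g : hom y z) (f f' : hom x y) (q : f = f') :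
  g ◁ eqm q = eqm (f_equal (comp1 g) q).
Proof. by case: f' / q; rewrite /= hcomp_id. Qed.

Lemma rw_eqm (x y z : B) (g g' : hom y z) (f : hom x y) (p : g = g') :
  eqm p ▷ f = eqm (f_equal (fun g => g ∘ f) p).
Proof. by case: g' / p; rewrite /= hcomp_id. Qed.

Lemma hcompA' (x y z w : B) (h h' : hom z w) (g g' : hom y z) (f f' : hom x y)
    (c : mor h h') (b : mor g g') (a : mor f f') :
  c ∗ (b ∗ a) = eqm (eq_sym (comp1A h' g' f')) • (((c ∗ b) ∗ a) • eqm (comp1A h g f)).
Proof. by rewrite -hcompA compmA eqm_comp eqm1 compm1l. Qed.

Lemma hcompA'' (x y z w : B) (h h' : hom z w) (g g' : hom y z) (f f' : hom x y)
    (c : mor h h') (b : mor g g') (a : mor f f') :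
  (c ∗ b) ∗ a = eqm (comp1A h' g' f') • ((c ∗ (b ∗ a)) • eqm (eq_sym (comp1A h g f))).
Proof. by rewrite compmA hcompA -compmA eqm_comp eqm1 compm1r. Qed.

Lemma lwA (x y z w : B) (h : hom z w) (g : hom y z) (f f' : hom x y) (a : mor f f') :
  h ◁ (g ◁ a)
  = eqm (eq_sym (comp1A h g f')) • (((h ∘ g) ◁ a) • eqm (comp1A h g f)).
Proof. by rewrite hcompA' hcomp_id. Qed.

Lemma rwA (x y z w : B) (h h' : hom z w) (g : hom y z) (f : hom x y) (c : mor h h') :
  (c ▷ g) ▷ f
  = eqm (comp1A h' g f) • ((c ▷ (g ∘ f)) • eqm (eq_sym (comp1A h g f))).
Proof. by rewrite hcompA'' hcomp_id. Qed.

Lemma lrA (x y z w : B) (h : hom z w) (g g' : hom y z) (f : hom x y) (b : mor g g') :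
  (h ◁ b) ▷ f
  = eqm (comp1A h g' f) • ((h ◁ (b ▷ f)) • eqm (eq_sym (comp1A h g f))).
Proof. by rewrite hcompA''. Qed.

Lemma lw1 (x y : B) (f f' : hom x y) (a : mor f f') :
  id1 y ◁ a = eqm (eq_sym (comp1l f')) • (a • eqm (comp1l f)).
Proof. by rewrite -hcomp1l compmA eqm_comp eqm1 compm1l. Qed.

Lemma rw1 (x y : B) (f f' : hom x y) (a : mor f f') :
  a ▷ id1 x = eqm (eq_sym (comp1r f')) • (a • eqm (comp1r f)).
Proof. by rewrite -hcomp1r compmA eqm_comp eqm1 compm1l. Qed.

Lemma lw_cast (x y z : B) (g g' : hom y z) (p : g = g') (f f' : hom x y) (a : mor f f') :
  g ◁ a = eqm (f_equal (fun g => g ∘ f') (eq_sym p))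
          • ((g' ◁ a) • eqm (f_equal (fun g => g ∘ f) p)).
Proof. by case: g' / p; rewrite /= compm1l compm1r. Qed.

Lemma rw_cast (x y z : B) (g g' : hom y z) (f f' : hom x y) (p : f = f') (b : mor g g') :
  b ▷ f = eqm (f_equal (comp1 g') (eq_sym p))
          • ((b ▷ f') • eqm (f_equal (comp1 g) p)).
Proof. by case: f' / p; rewrite /= compm1l compm1r. Qed.

Lemma is_iso_hcomp (x y z : B) (g g' : hom y z) (f f' : hom x y)
    (b : mor g g') (a : mor f f') : is_iso b -> is_iso a -> is_iso (b ∗ a).
Proof.
move=> [b' [b1 b2]] [a' [a1 a2]]; exists (b' ∗ a').
by rewrite -!hcomp_comp a1 a2 b1 b2 !hcomp_id.
Qed.

Lemma is_iso_id (C : Category) (x : C) : is_iso (idm x).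
Proof. by exists (idm x); rewrite compm1l. Qed.

End Whiskering.

Record PseudoFunctor (C D : TwoCat) := {
  pf0 :> C -> D;
  pf1 : forall x y : C, Functor (hom x y) (hom (pf0 x) (pf0 y));
  pf_id : forall x, mor (id1 (pf0 x)) (pf1 x x (id1 x));
  pf_comp : forall x y z (g : hom y z) (f : hom x y),
    mor (pf1 y z g ∘ pf1 x y f) (pf1 x z (g ∘ f));
  pf_id_iso : forall x, is_iso (pf_id x);
  pf_comp_iso : forall x y z (g : hom y z) (f : hom x y), is_iso (pf_comp g f);
  pf_comp_nat : forall x y z (g g' : hom y z) (f f' : hom x y)
      (b : mor g g') (a : mor f f'),
    fmor (pf1 x z) (b ∗ a) • pf_comp g f
    = pf_comp g' f' • (fmor (pf1 y z) b ∗ fmor (pf1 x y) a);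
  pf_unitl : forall x y (f : hom x y),
    fmor (pf1 x y) (eqm (comp1l f)) • pf_comp (id1 y) f • (pf_id y ▷ pf1 x y f)
    = eqm (comp1l (pf1 x y f));
  pf_unitr : forall x y (f : hom x y),
    fmor (pf1 x y) (eqm (comp1r f)) • pf_comp f (id1 x) • (pf1 x y f ◁ pf_id x)
    = eqm (comp1r (pf1 x y f));
  pf_assoc : forall x y z w (h : hom z w) (g : hom y z) (f : hom x y),
    fmor (pf1 x w) (eqm (comp1A h g f)) • pf_comp h (g ∘ f)
      • (pf1 z w h ◁ pf_comp g f)
    = pf_comp (h ∘ g) f • (pf_comp h g ▷ pf1 x y f)
      • eqm (comp1A (pf1 z w h) (pf1 y z g) (pf1 x y f))
}.
Arguments pf1 {C D} _ {x y}.
Arguments pf_id {C D} _ x.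
Arguments pf_comp {C D} _ {x y z} g f.

Record PseudoNat (C D : TwoCat) (F G : PseudoFunctor C D) := {
  pn0 :> forall x, hom (F x) (G x);
  pn1 : forall x y (f : hom x y), mor (pf1 G f ∘ pn0 x) (pn0 y ∘ pf1 F f);
  pn1_iso : forall x y (f : hom x y), is_iso (pn1 f);
  pn_nat : forall x y (f f' : hom x y) (a : mor f f'),
    pn1 f' • (fmor (pf1 G) a ▷ pn0 x) = (pn0 y ◁ fmor (pf1 F) a) • pn1 f;
  pn_id : forall x,
    pn1 (id1 x) • (pf_id G x ▷ pn0 x)
    = (pn0 x ◁ pf_id F x) • (eqm (eq_sym (comp1r (pn0 x))) • eqm (comp1l (pn0 x)));
  pn_comp : forall x y z (g : hom y z) (f : hom x y),
    pn1 (g ∘ f) • (pf_comp G g f ▷ pn0 x)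
    = (pn0 z ◁ pf_comp F g f) • eqm (eq_sym (comp1A (pn0 z) (pf1 F g) (pf1 F f)))
      • (pn1 g ▷ pf1 F f) • eqm (comp1A (pf1 G g) (pn0 y) (pf1 F f))
      • (pf1 G g ◁ pn1 f) • eqm (eq_sym (comp1A (pf1 G g) (pf1 G f) (pn0 x)))
}.
Arguments pn1 {C D F G} _ {x y} f.

Record Modification (C D : TwoCat) (F G : PseudoFunctor C D)
    (s t : PseudoNat F G) := {
  md :> forall x, mor (s x) (t x);
  md_nat : forall x y (f : hom x y),
    pn1 t f • (pf1 G f ◁ md x) = (md y ▷ pf1 F f) • pn1 s f
}.

Lemma PseudoNat_ext (C D : TwoCat) (F G : PseudoFunctor C D)
    (s t : PseudoNat F G) (e : forall x, s x = t x) :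
  (forall x y (f : hom x y),
    pn1 t f • (pf1 G f ◁ eqm (e x)) = (eqm (e y) ▷ pf1 F f) • pn1 s f) -> s = t.
Proof.
case: s t e => [s0 s1 i1 i2 i3 i4] [t0 t1 j1 j2 j3 j4] /= e H.
have e0 : s0 = t0 by apply: functional_extensionality_dep.
case: t0 / e0 t1 j1 j2 j3 j4 e H => t1 j1 j2 j3 j4 e H.
have e1 : s1 = t1.
  apply: functional_extensionality_dep => x.
  apply: functional_extensionality_dep => y.
  apply: functional_extensionality_dep => f.
  move: (H x y f).
  by rewrite !eqm1 !hcomp_id compm1r compm1l.
case: t1 / e1 j1 j2 j3 j4 H => j1 j2 j3 j4 _.
by rewrite (proof_irrelevance _ i1 j1) (proof_irrelevance _ i2 j2)
  (proof_irrelevance _ i3 j3) (proof_irrelevance _ i4 j4).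
Qed.

Lemma Modification_ext (C D : TwoCat) (F G : PseudoFunctor C D)
    (s t : PseudoNat F G) (r r' : Modification s t) :
  (forall x, r x = r' x) -> r = r'.
Proof.
case: r r' => [r i] [r' i'] /= H.
have e : r = r' by apply: functional_extensionality_dep.
by case: r' / e i' H => i' _; rewrite (proof_irrelevance _ i i').
Qed.

Program Definition PseudoNatCat (C D : TwoCat) (F G : PseudoFunctor C D) : Category :=
  {| obj := PseudoNat F G;
     mor := fun s t => Modification s t;
     idm := fun s => {| md := fun x => idm (s x) |};
     compm := fun s t u r' r => {| md := fun x => r' x • r x |} |}.
Next Obligation. by rewrite !hcomp_id compm1l compm1r. Qed.
Next Obligation.
by rewrite lw_comp rw_comp compmA md_nat -compmA md_nat compmA.
Qed.
Next Obligation. apply: Modification_ext => c /=; exact: compm1l. Qed.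
Next Obligation. apply: Modification_ext => c /=; exact: compm1r. Qed.
Next Obligation. apply: Modification_ext => c /=; exact: compmA. Qed.

Lemma eqm_md (C D : TwoCat) (F G : PseudoFunctor C D)
    (s t : PseudoNatCat F G) (e : s = t) (x : C) :
  md (eqm e) x = eqm (f_equal (fun s : PseudoNat F G => s x) e).
Proof. by case: t / e. Qed.

Ltac nf :=
  repeat (progress rewrite ?hcomp_id ?lw_comp ?rw_comp ?lw_eqm ?rw_eqm ?fmor_comp
    ?fmor_eqm ?lwA ?rwA ?lrA ?lw1 ?rw1);
  rewrite ?compm1l ?compm1r -?compmA; rewrite ?eqm_compA ?eqm_comp.
Ltac eqs := repeat first [reflexivity | exact: eqm_irr | congr (_ • _)].

Section Composition.
Context {C D : TwoCat}.

Program Definition id_pseudonat (F : PseudoFunctor C D) : PseudoNat F F :=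
  {| pn0 := fun x => id1 (F x);
     pn1 := fun x y f => eqm (eq_sym (comp1l (pf1 F f))) • eqm (comp1r (pf1 F f)) |}.
Next Obligation. apply: is_iso_comp; exact: eqm_iso. Qed.
Next Obligation. nf. eqs. Qed.
Next Obligation. nf. eqs. Qed.
Next Obligation. nf. eqs. Qed.

Program Definition comp_pseudonat (F G H : PseudoFunctor C D)
    (t : PseudoNat G H) (s : PseudoNat F G) : PseudoNat F H :=
  {| pn0 := fun x => t x ∘ s x;
     pn1 := fun x y f =>
       eqm (comp1A (t y) (s y) (pf1 F f)) • (t y ◁ pn1 s f)
       • eqm (eq_sym (comp1A (t y) (pf1 G f) (s x)))
       • (pn1 t f ▷ s x) • eqm (comp1A (pf1 H f) (t x) (s x)) |}.
Next Obligation.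
do ! apply: is_iso_comp; try exact: eqm_iso.
- apply: is_iso_hcomp; [exact: is_iso_id | exact: pn1_iso].
- apply: is_iso_hcomp; [exact: pn1_iso | exact: is_iso_id].
Qed.
Next Obligation.
have A := f_equal (fun z => z ▷ s x • eqm (comp1A _ _ _)) (pn_nat t a).
have A' := f_equal (fun z => t y ◁ z) (pn_nat s a).
move: A A' => /=; nf; rewrite ?eqm1 ?compm1r ?compm1l => A A'.
rewrite A; nf.
rewrite eqm1 compm1l.
rewrite (compmA (t y ◁ pn1 s f')) A'; nf.
by rewrite eqm1 compm1l.
Qed.
Next Obligation.
have A := f_equal (fun z => z ▷ s x • eqm (comp1A _ _ _)) (pn_id t x).
have A' := f_equal (fun z => t x ◁ z) (pn_id s x).
move: A A' => /=; nf; rewrite ?eqm1 ?compm1r ?compm1l => A A'.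
rewrite A; nf. rewrite eqm1 compm1l.
rewrite (compmA (t x ◁ pn1 s _)) A'; nf.
rewrite eqm1 compm1l. eqs.
Qed.
Next Obligation.
have A := f_equal (fun z => z ▷ s x • eqm (comp1A _ _ _)) (pn_comp t g f).
have A' := f_equal (fun v => t z ◁ v) (pn_comp s g f).
move: A A' => /=; nf; rewrite ?eqm1 ?compm1r ?compm1l => A A'.
rewrite A; nf. rewrite eqm1 compm1l.
rewrite (compmA (t z ◁ pn1 s _)) A'; nf.
rewrite !eqm1 !compm1l (compmA (t z ∘ pf1 G g ◁ pn1 s f)) -exchange; nf.
eqs.
Qed.

Program Definition hcomp_modification (F G H : PseudoFunctor C D)
    (t t' : PseudoNat G H) (s s' : PseudoNat F G)
    (b : Modification t t') (a : Modification s s') :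
    Modification (comp_pseudonat t s) (comp_pseudonat t' s') :=
  {| md := fun x => b x ∗ a x |}.
Next Obligation.
have A := f_equal (fun v => v ▷ s x • eqm (comp1A _ _ _)) (md_nat b f).
have A' := f_equal (fun v => t' y ◁ v) (md_nat a f).
rewrite (hcomp_lr (b x)) (hcomp_lr (b y)).
move: A A' => /=; nf; rewrite ?eqm1 ?compm1r ?compm1l => A A'.
rewrite (compmA (pn1 t' f ▷ s' x)) exchange -compmA A; nf.
rewrite (compmA (b y ▷ (s y ∘ _))) exchange -compmA.

by rewrite (compmA (t' y ◁ (a y ▷ _))) -A'; nf.
Qed.

Lemma comp_pseudonatA (F G H K : PseudoFunctor C D)
    (u : PseudoNat H K) (t : PseudoNat G H) (s : PseudoNat F G) :
  comp_pseudonat u (comp_pseudonat t s) = comp_pseudonat (comp_pseudonat u t) s.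
Proof.
unshelve eapply PseudoNat_ext; first (move=> x; exact: comp1A).
move=> x y f /=.
nf; rewrite ?eqm1 ?compm1l ?compm1r; eqs.
Qed.

Lemma comp_pseudonat1l (F G : PseudoFunctor C D) (s : PseudoNat F G) :
  comp_pseudonat (id_pseudonat G) s = s.
Proof.
unshelve eapply PseudoNat_ext; first (move=> x; exact: comp1l).
move=> x y f /=.
nf; rewrite ?eqm1 ?compm1l ?compm1r; eqs.
Qed.

Lemma comp_pseudonat1r (F G : PseudoFunctor C D) (s : PseudoNat F G) :
  comp_pseudonat s (id_pseudonat F) = s.
Proof.
unshelve eapply PseudoNat_ext; first (move=> x; exact: comp1r).
move=> x y f /=.
nf; rewrite ?eqm1 ?compm1l ?compm1r; eqs.
Qed.

End Composition.

Program Definition PseudoFun (C D : TwoCat) : TwoCat :=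
  {| ob := PseudoFunctor C D;
     hom := @PseudoNatCat C D;
     id1 := @id_pseudonat C D;
     comp1 := @comp_pseudonat C D;
     hcomp := @hcomp_modification C D;
     comp1A := fun F G H K u t s => comp_pseudonatA u t s;
     comp1l := @comp_pseudonat1l C D;
     comp1r := @comp_pseudonat1r C D |}.
Next Obligation. apply: Modification_ext => v /=; exact: hcomp_id. Qed.
Next Obligation. apply: Modification_ext => v /=; exact: hcomp_comp. Qed.
Next Obligation.
apply: Modification_ext => v; move: (hcompA (c v) (b v) (a v)).
rewrite /= !eqm_md /= => e.
rewrite (eqm_irr _ (comp1A (h' v) (g' v) (f' v))) e; congr (_ • _); exact: eqm_irr.
Qed.
Next Obligation.
apply: Modification_ext => v; move: (hcomp1l (a v)).
rewrite /= !eqm_md /= => e.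
rewrite (eqm_irr _ (comp1l (f' v))) e; congr (_ • _); exact: eqm_irr.
Qed.
Next Obligation.
apply: Modification_ext => v; move: (hcomp1r (a v)).
rewrite /= !eqm_md /= => e.
rewrite (eqm_irr _ (comp1r (f' v))) e; congr (_ • _); exact: eqm_irr.
Qed.

(* Unbundled over the map on objects, so that one can say that a given family
   of objects [F0 c] is 2-functorial in [c]. *)
Record TwoFunctorOn (C D : TwoCat) (F0 : C -> D) := {
  tf1 : forall x y : C, Functor (hom x y) (hom (F0 x) (F0 y));
  tf_id1 : forall x, tf1 x x (id1 x) = id1 (F0 x);
  tf_comp1 : forall x y z (g : hom y z) (f : hom x y),
    tf1 x z (g ∘ f) = tf1 y z g ∘ tf1 x y f;
  tf_hcomp : forall x y z (g g' : hom y z) (f f' : hom x y)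
      (b : mor g g') (a : mor f f'),
    eqm (tf_comp1 g' f') • fmor (tf1 x z) (b ∗ a)
    = (fmor (tf1 y z) b ∗ fmor (tf1 x y) a) • eqm (tf_comp1 g f)
}.
Arguments tf1 {C D F0} _ {x y}.
Arguments tf_id1 {C D F0} _ x.
Arguments tf_comp1 {C D F0} _ {x y z} g f.

Record TwoFunctor (C D : TwoCat) := {
  tf0 :> C -> D;
  tf_on :> TwoFunctorOn tf0
}.

Lemma tf_hcompE (C D : TwoCat) (F0 : C -> D) (F : TwoFunctorOn F0)
    (x y z : C) (g g' : hom y z) (f f' : hom x y) (b : mor g g') (a : mor f f') :
  fmor (tf1 F) (b ∗ a)
  = eqm (eq_sym (tf_comp1 F g' f'))
    • ((fmor (tf1 F) b ∗ fmor (tf1 F) a) • eqm (tf_comp1 F g f)).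
Proof. by rewrite -tf_hcomp compmA eqm_comp eqm1 compm1l. Qed.

Program Definition pseudo_of_2functor (C D : TwoCat) (F : TwoFunctor C D) :
    PseudoFunctor C D :=
  {| pf0 := F;
     pf1 := fun x y => tf1 F;
     pf_id := fun x => eqm (eq_sym (tf_id1 F x));
     pf_comp := fun x y z g f => eqm (eq_sym (tf_comp1 F g f)) |}.
Next Obligation. exact: eqm_iso. Qed.
Next Obligation. exact: eqm_iso. Qed.
Next Obligation. rewrite tf_hcompE; nf; rewrite ?eqm1 ?compm1r; eqs. Qed.
Next Obligation. nf; eqs. Qed.
Next Obligation. nf; eqs. Qed.
Next Obligation. nf; eqs. Qed.
Coercion pseudo_of_2functor : TwoFunctor >-> PseudoFunctor.

(* The structural 2-cells are identities, i.e. [G f ∘ s x] equals [s y ∘ F f] and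
   [pn1 s f] is the identity along this equality; [pn_nat] is then the
   2-naturality condition on 2-cells. *)
Definition is_2natural (C D : TwoCat) (F G : PseudoFunctor C D)
    (s : PseudoNat F G) : Prop :=
  forall (x y : C) (f : hom x y),
    exists e : pf1 G f ∘ s x = s y ∘ pf1 F f, pn1 s f = eqm e.

Lemma is_2natural_id (C D : TwoCat) (F : PseudoFunctor C D) :
  is_2natural (id_pseudonat F).
Proof. by move=> x y f; rewrite /= eqm_comp; eexists. Qed.

Lemma is_2natural_comp (C D : TwoCat) (F G H : PseudoFunctor C D)
    (t : PseudoNat G H) (s : PseudoNat F G) :
  is_2natural t -> is_2natural s -> is_2natural (comp_pseudonat t s).
Proof.
move=> Ht Hs x y f /=; have [p ->] := Ht x y f; have [q ->] := Hs x y f.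
by rewrite lw_eqm rw_eqm !eqm_comp; eexists.
Qed.

Program Definition full_sub2category (B : TwoCat) (T : Type) (u : T -> B) : TwoCat :=
  {| ob := T;
     hom := fun x y => @hom B (u x) (u y);
     id1 := fun x => id1 (u x);
     comp1 := fun x y z g f => g ∘ f;
     hcomp := fun x y z g g' f f' b a => b ∗ a;
     comp1A := fun x y z w h g f => comp1A h g f;
     comp1l := fun x y f => comp1l f;
     comp1r := fun x y f => comp1r f |}.
Next Obligation. exact: hcomp_id. Qed.
Next Obligation. exact: hcomp_comp. Qed.
Next Obligation. exact: hcompA. Qed.
Next Obligation. exact: hcomp1l. Qed.
Next Obligation. exact: hcomp1r. Qed.

Lemma full_subcategory_eq (C : Category) (P : C -> Prop)
    (x y : full_subcategory P) : proj1_sig x = proj1_sig y -> x = y.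
Proof.
case: x y => [x p] [y q] /= e; case: y / e q => q.
by rewrite (proof_irrelevance _ p q).
Qed.

Lemma eqm_sub (C : Category) (P : C -> Prop) (x y : full_subcategory P) (e : x = y) :
  eqm e = eqm (f_equal (@proj1_sig _ _) e) :> @mor C (proj1_sig x) (proj1_sig y).
Proof. by case: y / e. Qed.

Program Definition locally_full_sub2category (B : TwoCat)
    (P : forall x y : B, hom x y -> Prop)
    (P_id : forall x, P x x (id1 x))
    (P_comp : forall x y z (g : hom y z) (f : hom x y),
      P y z g -> P x y f -> P x z (g ∘ f)) : TwoCat :=
  {| ob := B;
     hom := fun x y => full_subcategory (P x y);
     id1 := fun x => exist _ (id1 x) (P_id x);
     comp1 := fun x y z g f =>
       exist _ (proj1_sig g ∘ proj1_sig f)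
         (P_comp x y z _ _ (proj2_sig g) (proj2_sig f));
     hcomp := fun x y z g g' f f' b a => hcomp (x := x) b a |}.
Next Obligation. exact: hcomp_id. Qed.
Next Obligation. exact: hcomp_comp. Qed.
Next Obligation. exact: (@full_subcategory_eq _ (P x w) (exist _ _ _) (exist _ _ _) (comp1A _ _ _)). Qed.
Next Obligation. exact: (@full_subcategory_eq _ (P x y) (exist _ _ _) f (comp1l _)). Qed.
Next Obligation. exact: (@full_subcategory_eq _ (P x y) (exist _ _ _) f (comp1r _)). Qed.
Next Obligation.
move: (hcompA c b a); rewrite !eqm_sub /= => e.
rewrite (eqm_irr _ (comp1A _ _ _)) e; congr (_ • _); exact: eqm_irr.
Qed.
Next Obligation.
move: (hcomp1l a); rewrite !eqm_sub /= => e.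
rewrite (eqm_irr _ (comp1l _)) e; congr (_ • _); exact: eqm_irr.
Qed.
Next Obligation.
move: (hcomp1r a); rewrite !eqm_sub /= => e.
rewrite (eqm_irr _ (comp1r _)) e; congr (_ • _); exact: eqm_irr.
Qed.

Definition Hom_p (C D : TwoCat) : TwoCat :=
  full_sub2category (@pseudo_of_2functor C D : _ -> PseudoFun C D).

Definition Hom (C D : TwoCat) : TwoCat :=
  locally_full_sub2category (B := Hom_p C D)
    (P := fun F G => @is_2natural C D F G)
    (fun F => is_2natural_id F)
    (fun F G H t s => @is_2natural_comp C D F G H t s).

Program Definition ev_p (C D : TwoCat) (c : C) : TwoFunctor (Hom_p C D) D :=
  {| tf0 := fun F : TwoFunctor C D => F c;
     tf_on := {|
       tf1 := fun F G => {|
         fobj := fun s : PseudoNat F G => s c;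
         fmor := fun s t (r : Modification s t) => r c |};
       tf_id1 := fun F => eq_refl;
       tf_comp1 := fun F G H t s => eq_refl |} |}.
Next Obligation. by []. Qed.
Next Obligation. by []. Qed.
Next Obligation. by rewrite compm1l compm1r. Qed.

Program Definition ev (C D : TwoCat) (c : C) : TwoFunctor (Hom C D) D :=
  {| tf0 := fun F : TwoFunctor C D => F c;
     tf_on := {|
       tf1 := fun F G => {|
         fobj := fun s => (proj1_sig s : PseudoNat F G) c;
         fmor := fun s t (r : Modification _ _) => r c |};
       tf_id1 := fun F => eq_refl;
       tf_comp1 := fun F G H t s => eq_refl |} |}.
Next Obligation. by []. Qed.
Next Obligation. by []. Qed.
Next Obligation. by rewrite compm1l compm1r. Qed.

Program Definition comp_2functor (I B B' : TwoCat)
    (G : TwoFunctor B B') (F : PseudoFunctor I B) : PseudoFunctor I B' :=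
  {| pf0 := fun i => G (F i);
     pf1 := fun i j => comp_functor (tf1 G) (pf1 F);
     pf_id := fun i => fmor (tf1 G) (pf_id F i) • eqm (eq_sym (tf_id1 G (F i)));
     pf_comp := fun i j k v u =>
       fmor (tf1 G) (pf_comp F v u) • eqm (eq_sym (tf_comp1 G (pf1 F v) (pf1 F u))) |}.
Next Obligation.
apply: is_iso_comp; [apply: is_iso_fmor; exact: pf_id_iso | exact: eqm_iso].
Qed.
Next Obligation.
apply: is_iso_comp; [apply: is_iso_fmor; exact: pf_comp_iso | exact: eqm_iso].
Qed.
Next Obligation.
rewrite compmA -fmor_comp pf_comp_nat fmor_comp tf_hcompE; nf.
rewrite ?eqm1 ?compm1r; eqs.
Qed.
Next Obligation.
have A := f_equal (fun v => fmor (tf1 G) v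
  • eqm (eq_sym (tf_comp1 G (id1 (F y)) (pf1 F f)))
  • (eqm (eq_sym (tf_id1 G (F y))) ▷ tf1 G (pf1 F f))) (pf_unitl F f).
move: A; rewrite !fmor_comp tf_hcompE; nf.
rewrite ?fmor_id ?eqm1 ?compm1l ?compm1r => A.
etransitivity; first (etransitivity; last exact: A); eqs.
Qed.
Next Obligation.
have A := f_equal (fun v => fmor (tf1 G) v
  • eqm (eq_sym (tf_comp1 G (pf1 F f) (id1 (F x))))
  • (tf1 G (pf1 F f) ◁ eqm (eq_sym (tf_id1 G (F x))))) (pf_unitr F f).
move: A; rewrite !fmor_comp tf_hcompE; nf.
rewrite ?fmor_id ?eqm1 ?compm1l ?compm1r => A.
etransitivity; first (etransitivity; last exact: A); eqs.
Qed.
Next Obligation.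
have A := f_equal (fun v => fmor (tf1 G) v
  • eqm (eq_sym (tf_comp1 G (pf1 F h) (pf1 F g ∘ pf1 F f)))
  • (tf1 G (pf1 F h) ◁ eqm (eq_sym (tf_comp1 G (pf1 F g) (pf1 F f))))) (pf_assoc F h g f).
move: A; rewrite !fmor_comp !tf_hcompE; nf.
rewrite ?fmor_id ?eqm1 ?compm1l ?compm1r => A.
etransitivity; first (etransitivity; last exact: A); eqs.
Qed.

Program Definition const_2functor (I B : TwoCat) (L : B) : TwoFunctor I B :=
  {| tf0 := fun _ => L;
     tf_on := {|
       tf1 := fun i j => {|
         fobj := fun _ => id1 L;
         fmor := fun _ _ _ => idm (id1 L) |};
       tf_id1 := fun _ => eq_refl;
       tf_comp1 := fun _ _ _ _ _ => eq_sym (comp1l (id1 L)) |} |}.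
Next Obligation. by []. Qed.
Next Obligation. by rewrite compm1l. Qed.
Next Obligation. by rewrite hcomp_id compm1l compm1r. Qed.

Program Definition const_pseudonat (I B : TwoCat) (L M : B) (f : hom L M) :
    PseudoNat (const_2functor I L) (const_2functor I M) :=
  {| pn0 := fun _ => f;
     pn1 := fun _ _ _ => eqm (eq_sym (comp1r f)) • eqm (comp1l f) |}.
Next Obligation. apply: is_iso_comp; exact: eqm_iso. Qed.
Next Obligation. by nf. Qed.
Next Obligation. nf; eqs. Qed.
Next Obligation. nf; eqs. Qed.

Program Definition const_modification (I B : TwoCat) (L M : B) (f g : hom L M)
    (a : mor f g) : Modification (const_pseudonat I f) (const_pseudonat I g) :=
  {| md := fun _ => a |}.
Next Obligation. nf; rewrite ?eqm1 ?compm1r; eqs. Qed.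

Definition PseudoCone (I B : TwoCat) (F : PseudoFunctor I B) (L : B) : Type :=
  PseudoNat F (const_2functor I L).

Definition PseudoConeCat (I B : TwoCat) (F : PseudoFunctor I B) (L : B) : Category :=
  PseudoNatCat F (const_2functor I L).

Program Definition precomp_cone (I B : TwoCat) (F : PseudoFunctor I B) (L : B)
    (l : PseudoCone F L) (M : B) : Functor (hom L M) (PseudoConeCat F M) :=
  {| fobj := fun f => comp_pseudonat (const_pseudonat I f) l;
     fmor := fun f g a =>
       hcomp_modification (const_modification I a) (idm (l : PseudoConeCat F L)) |}.
Next Obligation. apply: Modification_ext => i /=; by rewrite hcomp_id. Qed.
Next Obligation. apply: Modification_ext => i /=; by rewrite rw_comp. Qed.

Definition is_pseudocolimit (I B : TwoCat) (F : PseudoFunctor I B) (L : B)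
    (l : PseudoCone F L) : Prop :=
  forall M : B, is_cat_isomorphism (precomp_cone l M).

(* Pseudo-limits are taken over pseudo-natural transformations out of the
   constant 2-functor. *)
Definition DualPseudoCone (I B : TwoCat) (F : PseudoFunctor I B) (L : B) : Type :=
  PseudoNat (const_2functor I L) F.

Definition DualPseudoConeCat (I B : TwoCat) (F : PseudoFunctor I B) (L : B) :
  Category := PseudoNatCat (const_2functor I L) F.

Program Definition postcomp_cone (I B : TwoCat) (F : PseudoFunctor I B) (L : B)
    (l : DualPseudoCone F L) (M : B) : Functor (hom M L) (DualPseudoConeCat F M) :=
  {| fobj := fun f => comp_pseudonat l (const_pseudonat I f);
     fmor := fun f g a =>
       hcomp_modification (idm (l : DualPseudoConeCat F L)) (const_modification I a) |}.
Next Obligation. apply: Modification_ext => i /=; by rewrite hcomp_id. Qed.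
Next Obligation. apply: Modification_ext => i /=; by rewrite lw_comp. Qed.

Definition is_pseudolimit (I B : TwoCat) (F : PseudoFunctor I B) (L : B)
    (l : DualPseudoCone F L) : Prop :=
  forall M : B, is_cat_isomorphism (postcomp_cone l M).

(* The structural 2-cell at [u] is [G (pn1 l u)], up to the strict equalities
   [G (g ∘ f) = G g ∘ G f] and [G (id1 L) = id1 (G L)]. *)
Program Definition image_cone (I B B' : TwoCat) (G : TwoFunctor B B')
    (F : PseudoFunctor I B) (L : B) (l : PseudoCone F L) :
    PseudoCone (comp_2functor G F) (G L) :=
  {| pn0 := fun i => tf1 G (l i);
     pn1 := fun i j u =>
       eqm (tf_comp1 G (l j) (pf1 F u)) • fmor (tf1 G) (pn1 l u)
       • eqm (eq_sym (tf_comp1 G (id1 L) (l i)))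
       • (eqm (eq_sym (tf_id1 G L)) ▷ tf1 G (l i)) |}.
Next Obligation.
do !apply: is_iso_comp; try exact: eqm_iso.
- apply: is_iso_fmor; exact (pn1_iso l _).
- apply: is_iso_hcomp; [exact: eqm_iso | exact: is_iso_id].
Qed.
Next Obligation.
have e : id1 (G L) ∘ tf1 G (l x) = tf1 G (id1 L ∘ l x).
  by rewrite tf_comp1 tf_id1.
have A := f_equal (fun v => eqm (tf_comp1 G (l y) (pf1 F f'))
  • (fmor (tf1 G) v • eqm e)) (pn_nat l a).
move: A => /=; rewrite !fmor_comp !tf_hcompE !fmor_id; nf.
rewrite ?eqm1 ?compm1r ?compm1l => A.
etransitivity; first (etransitivity; last exact: A); eqs.
Qed.
Next Obligation.
have e : id1 (G L) ∘ tf1 G (l x) = tf1 G (id1 L ∘ l x).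
  by rewrite tf_comp1 tf_id1.
have A := f_equal (fun v => eqm (tf_comp1 G (l x) (pf1 F (id1 x)))
  • (fmor (tf1 G) v • eqm e)) (pn_id l x).
move: A => /=; rewrite !fmor_comp !tf_hcompE !fmor_id; nf.
rewrite ?eqm1 ?compm1r ?compm1l => A.
etransitivity; first (etransitivity; last exact: A); eqs.
Qed.
Next Obligation.
have e : id1 (G L) ∘ id1 (G L) ∘ tf1 G (l x) = tf1 G (id1 L ∘ id1 L ∘ l x).
  by rewrite !tf_comp1 !tf_id1.
have A := f_equal (fun v => eqm (tf_comp1 G (l z) (pf1 F (g ∘ f)))
  • (fmor (tf1 G) v • eqm e)) (pn_comp l g f).
move: A => /=; rewrite !fmor_comp !tf_hcompE !fmor_id.
rewrite (lw_cast (tf_id1 G L)); nf.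
rewrite ?eqm1 ?compm1r ?compm1l => A.
etransitivity; first (etransitivity; last exact: A); eqs.
Qed.

Program Definition image_dual_cone (I B B' : TwoCat) (G : TwoFunctor B B')
    (F : PseudoFunctor I B) (L : B) (l : DualPseudoCone F L) :
    DualPseudoCone (comp_2functor G F) (G L) :=
  {| pn0 := fun i => tf1 G (l i);
     pn1 := fun i j u =>
       (tf1 G (l j) ◁ eqm (tf_id1 G L))
       • eqm (tf_comp1 G (l j) (id1 L))
       • fmor (tf1 G) (pn1 l u) • eqm (eq_sym (tf_comp1 G (pf1 F u) (l i))) |}.
Next Obligation.
do !apply: is_iso_comp; try exact: eqm_iso.
- apply: is_iso_hcomp; [exact: is_iso_id | exact: eqm_iso].
- apply: is_iso_fmor; exact (pn1_iso l _).
Qed.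
Next Obligation.
have e : tf1 G (l y ∘ id1 L) = tf1 G (l y) ∘ id1 (G L).
  by rewrite tf_comp1 tf_id1.
have A := f_equal (fun v => eqm e • fmor (tf1 G) v
  • eqm (eq_sym (tf_comp1 G (pf1 F f) (l x)))) (pn_nat l a).
move: A => /=; rewrite !fmor_comp !tf_hcompE !fmor_id; nf.
rewrite ?eqm1 ?compm1r ?compm1l => A.
etransitivity; first (etransitivity; last exact: A); eqs.
Qed.
Next Obligation.
have e : tf1 G (l x ∘ id1 L) = tf1 G (l x) ∘ id1 (G L).
  by rewrite tf_comp1 tf_id1.
have A := f_equal (fun v => eqm e • fmor (tf1 G) v
  • eqm (eq_sym (tf_comp1 G (id1 (F x)) (l x)))
  • (eqm (eq_sym (tf_id1 G (F x))) ▷ tf1 G (l x))) (pn_id l x).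
move: A => /=; rewrite !fmor_comp !tf_hcompE !fmor_id; nf.
rewrite ?eqm1 ?compm1r ?compm1l => A.
etransitivity; first (etransitivity; last exact: A); eqs.
Qed.
Next Obligation.
have e : tf1 G (l z ∘ id1 L) = tf1 G (l z) ∘ id1 (G L).
  by rewrite tf_comp1 tf_id1.
have A := f_equal (fun v => eqm e • fmor (tf1 G) v
  • eqm (eq_sym (tf_comp1 G (pf1 F g ∘ pf1 F f) (l x)))
  • (eqm (eq_sym (tf_comp1 G (pf1 F g) (pf1 F f))) ▷ tf1 G (l x)))
  (pn_comp l g f).
move: A => /=; rewrite !fmor_comp !tf_hcompE !fmor_id.
rewrite (rw_cast (tf_id1 G L)); nf.
rewrite ?eqm1 ?compm1r ?compm1l => A.
etransitivity; first (etransitivity; last exact: A); eqs.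
Qed.

(* Main.v *)
Require Import Defs.
From Stdlib Require Import FunctionalExtensionality ProofIrrelevance ClassicalEpsilon.
From Stdlib Require Import ssreflect ssrfun ssrbool.

(* A pseudo-functor [F : I -> Hom_p C D] transposes to a strict 2-functor
   [G : C -> PseudoFun I D] with [G c = ev c . F]; the 2-cell of [G f] at [u] is the
   inverse of the 2-cell of the pseudo-natural transformation [F u] at [f].  If [Delta]
   is the diagonal 2-functor [D -> PseudoFun I D], the pseudo-colimit cone [l c] is a
   universal arrow [G c -> Delta (L0 c)].  Such a pointwise family of universal arrows
   makes [L0] a 2-functor and [l] 2-natural, and pseudo-natural transformations
   [G -> Delta M] factor uniquely through [l]; transposing back, these are the
   pseudo-cones of [F] with vertex [M].  A pseudo-natural transformation out of [L] is
   2-natural as soon as its composites with the cone are, because a 2-cell is an identity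
   if its whiskerings with the universal arrow are; hence the same cone is universal in
   [Hom C D].  Pseudo-limits are treated in the same way with universal arrows
   [Delta (L0 c) -> G c]. *)

Set Implicit Arguments.
Unset Strict Implicit.
Unset Printing Implicit Defensive.
Local Obligation Tactic := cbn; intros.

(** * Cells up to strict equalities of their boundaries *)

(* [F] is pseudo only in [i]; each [F i] is a strict 2-functor of [c], which is why the transpose is
   strict. The lifted [L] is strict too, because the universal property is an isomorphism of
   categories and not an equivalence: lifts along [l c] exist with equality and are unique, and the
   equation defining the lift of [l c' ∘ tf1 G f] is already the 2-naturality of [l]. The main
   obstacle is that every law for 2-cells is typed along equalities of 1-cells; comparing cells
   rather than morphisms removes these transports. The limit half is not read off from opposite
   2-categories: reversing 1-cells alone would also turn around the structural 2-cells [pn1] of a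
   cone, so the argument is run a second time with whiskering on the other side. For [Hom], local
   fullness leaves only one point to settle, namely that the mediating 1-cell is 2-natural. *)
Reserved Notation "⌈ a ⌉" (at level 0, a at level 99, format "⌈ a ⌉").
Reserved Notation "b ⊙ a" (at level 52, right associativity).

(* Bundling a morphism with its endpoints lets Leibniz equality compare 2-cells whose
   boundaries agree only propositionally: as a cell, [eqm e] is an identity. *)
Record Cell (C : Category) := { cdom : C; ccod : C; cmor : mor cdom ccod }.

Definition cell (C : Category) (x y : C) (a : mor x y) : option (Cell C) :=
  Some {| cmor := a |}.
Notation "⌈ a ⌉" := (cell a) : cat_scope.

(* The partial composition, made total by [None], is associative without side
   conditions. *)
Definition vcomp (C : Category) (b a : option (Cell C)) : option (Cell C) :=
  match b, a with
  | Some b, Some a =>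
      match excluded_middle_informative (ccod a = cdom b) with
      | left e => ⌈cmor b • (eqm e • cmor a)⌉
      | right _ => None
      end
  | _, _ => None
  end.
Notation "b ⊙ a" := (vcomp b a) : cat_scope.

Section Cells.
Context {C : Category}.

(** An equality of bundled cells is turned into a square with [eqm]s along arbitrary proofs that the
    boundaries agree; for a common boundary these proofs may be taken reflexive, so no dependent
    elimination on the endpoints remains. *)
Lemma cell_inj (x y : C) (a b : mor x y) : ⌈a⌉ = ⌈b⌉ -> a = b.
Proof.
have K : forall (c d : Cell C) (p : cdom c = cdom d) (q : ccod c = ccod d),
    Some c = Some d -> eqm q • cmor c = cmor d • eqm p.
  by move=> c d p q [e]; case: d / e p q => p q; rewrite !eqm1 compm1l compm1r.
move=> e; have := K {| cmor := a |} {| cmor := b |} eq_refl eq_refl e.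
by rewrite /= compm1l compm1r.
Qed.

Lemma cell_comp (x y z : C) (b : mor y z) (a : mor x y) : ⌈b • a⌉ = ⌈b⌉ ⊙ ⌈a⌉.
Proof.
rewrite /vcomp /=; case: excluded_middle_informative => //= e.
by rewrite eqm1 compm1l.
Qed.

Lemma cell_eqm (x y : C) (p : x = y) : ⌈eqm p⌉ = ⌈idm x⌉.
Proof. by case: y / p. Qed.

Lemma cell_eqml (x y z : C) (p : y = z) (a : mor x y) : ⌈eqm p • a⌉ = ⌈a⌉.
Proof. by case: z / p; rewrite compm1l. Qed.

Lemma cell_eqmr (x y z : C) (p : x = y) (a : mor y z) : ⌈a • eqm p⌉ = ⌈a⌉.
Proof. by move: a; case: y / p => a; rewrite compm1r. Qed.

Lemma cell_dom (x y x' y' : C) (a : mor x y) (a' : mor x' y') : ⌈a⌉ = ⌈a'⌉ -> x = x'.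
Proof. by case. Qed.

Lemma cell_cod (x y x' y' : C) (a : mor x y) (a' : mor x' y') : ⌈a⌉ = ⌈a'⌉ -> y = y'.
Proof. by case. Qed.

Lemma vcompA (c b a : option (Cell C)) : (c ⊙ b) ⊙ a = c ⊙ b ⊙ a.
Proof.
case: c => [[z w c]|] //; case: b => [[y' y b]|] //; case: a => [[x x' a]|];
  last by rewrite /vcomp /=; case: excluded_middle_informative.
rewrite /vcomp /=; case: excluded_middle_informative => /= [e|ne];
  case: excluded_middle_informative => //= e'; last by case: excluded_middle_informative.
by case: excluded_middle_informative => // e''; rewrite (proof_irrelevance _ e'' e) !compmA.
Qed.

Lemma vcomp1l (x y : C) (a : mor x y) : ⌈idm y⌉ ⊙ ⌈a⌉ = ⌈a⌉.
Proof. by rewrite -cell_comp compm1l. Qed.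

Lemma vcomp1r (x y : C) (a : mor x y) : ⌈a⌉ ⊙ ⌈idm x⌉ = ⌈a⌉.
Proof. by rewrite -cell_comp compm1r. Qed.

Lemma vcomp_unitl (x y z : C) (a : mor x y) : z = y -> ⌈idm z⌉ ⊙ ⌈a⌉ = ⌈a⌉.
Proof. by move=> ->; exact: vcomp1l. Qed.

Lemma vcomp_unitr (x y z : C) (a : mor x y) : z = x -> ⌈a⌉ ⊙ ⌈idm z⌉ = ⌈a⌉.
Proof. by move=> ->; exact: vcomp1r. Qed.

Definition castm (x y x' y' : C) (p : x = x') (q : y = y') (a : mor x y) : mor x' y' :=
  eqm q • (a • eqm (eq_sym p)).

Lemma cell_castm (x y x' y' : C) (p : x = x') (q : y = y') (a : mor x y) :
  ⌈castm p q a⌉ = ⌈a⌉.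
Proof. by rewrite /castm cell_eqml cell_eqmr. Qed.

(** [is_iso] is a mere existence statement, while [istr] needs the inverse as data; it is extracted
    by choice. *)
Definition inv (x y : C) (a : mor x y) (ia : is_iso a) : mor y x :=
  proj1_sig (constructive_indefinite_description _ ia).

Lemma invl (x y : C) (a : mor x y) (ia : is_iso a) : inv ia • a = idm x.
Proof. by rewrite /inv; case: constructive_indefinite_description => ? []. Qed.

Lemma invr (x y : C) (a : mor x y) (ia : is_iso a) : a • inv ia = idm y.
Proof. by rewrite /inv; case: constructive_indefinite_description => ? []. Qed.

Lemma inv_iso (x y : C) (a : mor x y) (ia : is_iso a) : is_iso (inv ia).
Proof. by exists a; rewrite invl invr. Qed.

(** Cancellation of [s] is legitimate only for a defined composite: when [b] is not composable with
    [s], both sides of the hypothesis are [None] and nothing is known about [b]. *)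
Lemma vcompVK (x y : C) (s : mor x y) (si : is_iso s) (b t : option (Cell C)) :
  ⌈s⌉ ⊙ b = t -> ⌈s⌉ ⊙ b <> None -> b = ⌈inv si⌉ ⊙ t.
Proof.
move=> <- ne; rewrite -vcompA -cell_comp invl.
case: b ne => [[x' y' b]|] //=; rewrite /vcomp /=.
case: excluded_middle_informative => // e' _; move: (e') b.
by case: x / e' s si => s si e' b; rewrite /= eqm1 !compm1l.
Qed.

(** The object [z] is allowed to be a reassociated or unit-reduced form of [y], as happens for the
    inverses at identities and composites. *)
Lemma inv_unique (x y z : C) (s : mor x y) (si : is_iso s) (b : option (Cell C)) :
  y = z -> ⌈s⌉ ⊙ b = ⌈idm z⌉ -> ⌈inv si⌉ = b.
Proof. by move=> <- e; rewrite (vcompVK si e) ?vcomp1r ?e. Qed.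

Lemma inv_square (x y z w : C) (s : mor x y) (si : is_iso s) (s' : mor z w)
    (si' : is_iso s') (b : mor x z) (a : mor y w) :
  s' • b = a • s -> b • inv si = inv si' • a.
Proof.
move=> e; rewrite -(compm1l (b • _)) -(invl si') -compmA (compmA s') e.
by rewrite -compmA invr compm1r.
Qed.

End Cells.

(** * Functors and isomorphisms of categories, seen through cells *)

Section FunctorCells.
Context {C D : Category}.

Lemma cell_fmor (F : Functor C D) (x y x' y' : C) (a : mor x y) (a' : mor x' y') :
  ⌈a⌉ = ⌈a'⌉ -> ⌈fmor F a⌉ = ⌈fmor F a'⌉.
Proof.
move=> e; have p := cell_dom e; have q := cell_cod e.
case: x' / p a' e; case: y' / q => a' e; by rewrite (cell_inj e).
Qed.

(** Agreement on objects is not assumed separately: it is the agreement of the sources of the cells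
    at identities. *)
Lemma Functor_ext (F G : Functor C D) :
  (forall x y (a : mor x y), ⌈fmor F a⌉ = ⌈fmor G a⌉) -> F = G.
Proof.
move=> H; have e0 : forall x, F x = G x by move=> x; exact: cell_dom (H x x (idm x)).
case: F G H e0 => [F0 F1 i j] [G0 G1 k l] /= H e0.
have e : F0 = G0 by exact: functional_extensionality_dep.
case: G0 / e G1 k l H {e0} => G1 k l H.
have e1 : F1 = G1.
  apply: functional_extensionality_dep => x.
  apply: functional_extensionality_dep => y.
  apply: functional_extensionality_dep => a; exact: cell_inj.
case: G1 / e1 k l H => k l _.
by rewrite (proof_irrelevance _ i k) (proof_irrelevance _ j l).
Qed.

End FunctorCells.

(** The inverse is chosen on objects and on morphisms separately; faithfulness makes the choices
    functorial and injectivity on objects makes them inverse on the nose. These four clauses are the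
    form in which every universal property below is used and proved. *)
Lemma cat_isomorphismP (C D : Category) (T : Functor C D) :
  is_cat_isomorphism T <->
  [/\ forall y, exists x, T x = y,
      forall x x', T x = T x' -> x = x',
      forall x x' (g : mor (T x) (T x')), exists f, fmor T f = g
    & forall x x' (f f' : mor x x'), fmor T f = fmor T f' -> f = f'].
Proof.
split=> [[G [GT TG]]|[sur inj full faith]]; last first.
  have [g0 Tg0] : {g0 : D -> C | forall y, T (g0 y) = y}.
    exists (fun y => proj1_sig (constructive_indefinite_description _ (sur y))) => y.
    by case: constructive_indefinite_description.
  have [g1 Tg1] : {g1 : forall y y', mor y y' -> mor (g0 y) (g0 y') |
      forall y y' (a : mor y y'), ⌈fmor T (g1 y y' a)⌉ = ⌈a⌉}.
    exists (fun y y' a => proj1_sig (constructive_indefinite_description _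
      (full _ _ (castm (eq_sym (Tg0 y)) (eq_sym (Tg0 y')) a)))) => y y' a.
    by case: constructive_indefinite_description => b /= ->; rewrite cell_castm.
  have g_id : forall y, g1 y y (idm y) = idm (g0 y).
    move=> y; apply: faith; apply: cell_inj; rewrite Tg1 fmor_id.
    exact: (f_equal (fun z => ⌈idm z⌉) (eq_sym (Tg0 y))).
  have g_comp : forall x y z (b : mor y z) (a : mor x y),
      g1 x z (b • a) = g1 y z b • g1 x y a.
    move=> x y z b a; apply: faith; apply: cell_inj.
    by rewrite Tg1 fmor_comp !cell_comp !Tg1.
  have gT0 : forall x, g0 (T x) = x by move=> x; apply: inj.
  exists {| fobj := g0; fmor := g1; fmor_id := g_id; fmor_comp := g_comp |}.
  split; apply: Functor_ext => x y a /=; last exact: Tg1.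
  rewrite -(cell_castm (gT0 x) (gT0 y)); congr (cell _); apply: faith; apply: cell_inj.
  rewrite -[RHS]Tg1; apply: cell_fmor; exact: cell_castm.
have GT0 : forall x, G (T x) = x by move=> x; exact: (f_equal (fun H : Functor C C => H x) GT).
have GT1 : forall x y (a : mor x y), ⌈fmor G (fmor T a)⌉ = ⌈a⌉.
  by move=> x y a; exact: (f_equal (fun H : Functor C C => ⌈fmor H a⌉) GT).
have TG1 : forall x y (a : mor x y), ⌈fmor T (fmor G a)⌉ = ⌈a⌉.
  by move=> x y a; exact: (f_equal (fun H : Functor D D => ⌈fmor H a⌉) TG).
split.
- by move=> y; exists (G y); exact: (f_equal (fun H : Functor D D => H y) TG).
- by move=> x x' e; rewrite -(GT0 x) e.
- move=> x x' g; exists (castm (GT0 x) (GT0 x') (fmor G g)).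
  apply: cell_inj; rewrite -[RHS]TG1; apply: cell_fmor; exact: cell_castm.
- by move=> x x' f f' e; apply: cell_inj; rewrite -GT1 e GT1.
Qed.

(** * Whiskering of cells *)

Section Whiskers.
Context {B : TwoCat}.

Definition lw (x y z : B) (g : hom y z) (a : option (Cell (hom x y))) :
    option (Cell (hom x z)) :=
  if a is Some a then ⌈g ◁ cmor a⌉ else None.

Definition rw (x y z : B) (f : hom x y) (b : option (Cell (hom y z))) :
    option (Cell (hom x z)) :=
  if b is Some b then ⌈cmor b ▷ f⌉ else None.

Lemma cell_lw (x y z : B) (g : hom y z) (f f' : hom x y) (a : mor f f') :
  ⌈g ◁ a⌉ = lw g ⌈a⌉.
Proof. by []. Qed.

Lemma cell_rw (x y z : B) (f : hom x y) (g g' : hom y z) (b : mor g g') :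
  ⌈b ▷ f⌉ = rw f ⌈b⌉.
Proof. by []. Qed.

Lemma cell_hcomp (x y z : B) (g g' : hom y z) (f f' : hom x y)
    (b : mor g g') (a : mor f f') : ⌈b ∗ a⌉ = lw g' ⌈a⌉ ⊙ rw f ⌈b⌉.
Proof. by rewrite hcomp_lr cell_comp. Qed.

Lemma lw_lw (x y z w : B) (h : hom z w) (g : hom y z) (a : option (Cell (hom x y))) :
  lw (h ∘ g) a = lw h (lw g a).
Proof.
case: a => [[f f' a]|] //=.
by rewrite lwA cell_eqml cell_eqmr.
Qed.

Lemma rw_rw (x y z w : B) (g : hom y z) (f : hom x y) (c : option (Cell (hom z w))) :
  rw (g ∘ f) c = rw f (rw g c).
Proof.
case: c => [[h h' c]|] //=.
by rewrite rwA cell_eqml cell_eqmr.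
Qed.

Lemma rw_lw (x y z w : B) (h : hom z w) (f : hom x y) (b : option (Cell (hom y z))) :
  rw f (lw h b) = lw h (rw f b).
Proof.
case: b => [[g g' b]|] //=.
by rewrite lrA cell_eqml cell_eqmr.
Qed.

Lemma lw_id (x y : B) (a : option (Cell (hom x y))) : lw (id1 y) a = a.
Proof.
case: a => [[f f' a]|] //=.
by rewrite lw1 cell_eqml cell_eqmr.
Qed.

Lemma rw_id (x y : B) (a : option (Cell (hom x y))) : rw (id1 x) a = a.
Proof.
case: a => [[f f' a]|] //=.
by rewrite rw1 cell_eqml cell_eqmr.
Qed.

Lemma lw_idm (x y z : B) (g : hom y z) (f : hom x y) : lw g ⌈idm f⌉ = ⌈idm (g ∘ f)⌉.
Proof. by rewrite /= hcomp_id. Qed.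

Lemma rw_idm (x y z : B) (g : hom y z) (f : hom x y) : rw f ⌈idm g⌉ = ⌈idm (g ∘ f)⌉.
Proof. by rewrite /= hcomp_id. Qed.

(* Whiskering need not reflect composability, whence the side conditions. *)
Lemma lw_vcomp (x y z : B) (g : hom y z) (b a : option (Cell (hom x y)))
    (f f' : hom x y) (c : mor f f') :
  b ⊙ a = ⌈c⌉ -> lw g (b ⊙ a) = lw g b ⊙ lw g a.
Proof.
case: b a => [[h h' b]|] [[k k' a]|] //=.
case: excluded_middle_informative => // e _; move: (e) b; case: h / e => e b.
by rewrite eqm1 compm1l [lw g _]/(lw _ _) /= lw_comp cell_comp.
Qed.

Lemma rw_vcomp (x y z : B) (f : hom x y) (b a : option (Cell (hom y z)))
    (g g' : hom y z) (c : mor g g') :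
  b ⊙ a = ⌈c⌉ -> rw f (b ⊙ a) = rw f b ⊙ rw f a.
Proof.
case: b a => [[h h' b]|] [[k k' a]|] //=.
case: excluded_middle_informative => // e _; move: (e) b; case: h / e => e b.
by rewrite eqm1 compm1l /= rw_comp cell_comp.
Qed.

(** The 2-cell [c] certifies that the composite is defined, so an equation such as [tf_hcomp_cell]
    can be used directly for rewriting under a whiskering. *)
Lemma lw_split (x y z : B) (g : hom y z) (b a : option (Cell (hom x y)))
    (f f' : hom x y) (c : mor f f') :
  ⌈c⌉ = b ⊙ a -> lw g ⌈c⌉ = lw g b ⊙ lw g a.
Proof. by move=> e; rewrite e; apply: lw_vcomp (esym e). Qed.

Lemma rw_split (x y z : B) (f : hom x y) (b a : option (Cell (hom y z)))
    (g g' : hom y z) (c : mor g g') :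
  ⌈c⌉ = b ⊙ a -> rw f ⌈c⌉ = rw f b ⊙ rw f a.
Proof. by move=> e; rewrite e; apply: rw_vcomp (esym e). Qed.

Lemma lw_invr (x y z : B) (g : hom y z) (f f' : hom x y) (s : mor f f') (si : is_iso s) :
  lw g ⌈s⌉ ⊙ lw g ⌈inv si⌉ = ⌈idm (g ∘ f')⌉.
Proof. by rewrite -!cell_lw -cell_comp -lw_comp invr hcomp_id. Qed.

Lemma lw_invl (x y z : B) (g : hom y z) (f f' : hom x y) (s : mor f f') (si : is_iso s) :
  lw g ⌈inv si⌉ ⊙ lw g ⌈s⌉ = ⌈idm (g ∘ f)⌉.
Proof. by rewrite -!cell_lw -cell_comp -lw_comp invl hcomp_id. Qed.

Lemma rw_invr (x y z : B) (f : hom x y) (g g' : hom y z) (s : mor g g') (si : is_iso s) :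
  rw f ⌈s⌉ ⊙ rw f ⌈inv si⌉ = ⌈idm (g' ∘ f)⌉.
Proof. by rewrite -!cell_rw -cell_comp -rw_comp invr hcomp_id. Qed.

Lemma rw_invl (x y z : B) (f : hom x y) (g g' : hom y z) (s : mor g g') (si : is_iso s) :
  rw f ⌈inv si⌉ ⊙ rw f ⌈s⌉ = ⌈idm (g ∘ f)⌉.
Proof. by rewrite -!cell_rw -cell_comp -rw_comp invl hcomp_id. Qed.

End Whiskers.
Arguments lw : simpl never.
Arguments rw : simpl never.
Arguments cell : simpl never.
Arguments vcomp : simpl never.

(* Normalizes the cell of a pasting diagram: [eqm]'s are erased and whiskerings are
   nested, with left whiskerings outermost. *)
Ltac cells :=
  repeat (progress rewrite ?hcomp_id ?lw_comp ?rw_comp ?fmor_comp ?fmor_id ?fmor_eqm ?lw_eqm ?rw_eqm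
    ?compm1l ?compm1r ?compmA ?eqm_comp);
  repeat (progress rewrite ?(cell_eqml, cell_eqmr, cell_comp));
  rewrite ?vcompA ?cell_eqm ?cell_lw ?cell_rw;
  repeat (progress rewrite ?lw_lw ?rw_rw ?rw_lw ?lw_id ?rw_id).

(** * Pseudo-natural transformations and modifications compared by cells *)

Lemma PseudoNat_cell_ext (C D : TwoCat) (F G : PseudoFunctor C D) (s t : PseudoNat F G) :
  (forall x, s x = t x) -> (forall x y (f : hom x y), ⌈pn1 s f⌉ = ⌈pn1 t f⌉) -> s = t.
Proof.
move=> e H; apply: (PseudoNat_ext (e := e)) => x y f.
by apply: cell_inj; rewrite lw_eqm rw_eqm cell_eqml cell_eqmr.
Qed.

Lemma md_nat_cell (C D : TwoCat) (F G : PseudoFunctor C D) (s t : PseudoNat F G)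
    (r : Modification s t) (x y : C) (f : hom x y) :
  ⌈pn1 t f⌉ ⊙ lw (pf1 G f) ⌈r x⌉ = rw (pf1 F f) ⌈r y⌉ ⊙ ⌈pn1 s f⌉.
Proof. by rewrite -cell_lw -cell_rw -!cell_comp md_nat. Qed.

Lemma Modification_cell_ext (C D : TwoCat) (F G : PseudoFunctor C D)
    (s t s' t' : PseudoNatCat F G) (r : mor s t) (r' : mor s' t') :
  s = s' -> t = t' -> (forall x, ⌈md r x⌉ = ⌈md r' x⌉) -> ⌈r⌉ = ⌈r'⌉.
Proof.
move=> p q; case: s' / p r'; case: t' / q => r' H.
by congr (cell _); apply: Modification_ext => x; exact: cell_inj.
Qed.

Lemma cell_md (C D : TwoCat) (F G : PseudoFunctor C D)
    (s t s' t' : PseudoNatCat F G) (r : mor s t) (r' : mor s' t') (x : C) :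
  ⌈r⌉ = ⌈r'⌉ -> ⌈md r x⌉ = ⌈md r' x⌉.
Proof.
move=> e; have p := cell_dom e; have q := cell_cod e.
by case: s' / p r' e; case: t' / q => r' e; rewrite (cell_inj e).
Qed.

Lemma cell_md_comp (C D : TwoCat) (F G : PseudoFunctor C D) (s t t' u : PseudoNatCat F G)
    (b : mor t' u) (p : t = t') (a : mor s t) (x : C) :
  ⌈md (b • (eqm p • a)) x⌉ = ⌈md b x⌉ ⊙ ⌈md a x⌉.
Proof. by case: t' / p b => b; rewrite compm1l; exact: cell_comp. Qed.

(** The modification law of [r], with [eqm]s for components, is exactly the hypothesis of
    [PseudoNat_ext]; hence source and target coincide as pseudo-natural transformations and not only
    objectwise. *)
Lemma modification_eqm (C D : TwoCat) (F G : PseudoFunctor C D) (s t : PseudoNatCat F G)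
    (r : mor s t) : (forall x, exists e, md r x = eqm e) -> exists e, r = eqm e.
Proof.
move=> H.
have e x : (s : PseudoNat F G) x = (t : PseudoNat F G) x by case: (H x).
have re x : md r x = eqm (e x) by case: (H x) => e' ->; exact: eqm_irr.
have st : s = t.
  by apply: (PseudoNat_ext (e := e)) => x y f; rewrite -!re md_nat.
exists st; apply: Modification_ext => x; rewrite re eqm_md; exact: eqm_irr.
Qed.

(** * Universal arrows to and from a 2-functor *)

Lemma tf_hcomp_cell (C' D' : TwoCat) (F0 : C' -> D') (F : TwoFunctorOn F0)
    (x y z : C') (g g' : hom y z) (f f' : hom x y) (b : mor g g') (a : mor f f') :
  ⌈fmor (tf1 F) (b ∗ a)⌉
  = lw (tf1 F g') ⌈fmor (tf1 F) a⌉ ⊙ rw (tf1 F f) ⌈fmor (tf1 F) b⌉.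
Proof. by rewrite tf_hcompE cell_eqml cell_eqmr cell_hcomp. Qed.

Lemma tf_lw_cell (C' D' : TwoCat) (F0 : C' -> D') (F : TwoFunctorOn F0)
    (x y z : C') (g : hom y z) (f f' : hom x y) (a : mor f f') :
  ⌈fmor (tf1 F) (g ◁ a)⌉ = lw (tf1 F g) ⌈fmor (tf1 F) a⌉.
Proof. by rewrite tf_hcompE; cells. Qed.

Lemma tf_rw_cell (C' D' : TwoCat) (F0 : C' -> D') (F : TwoFunctorOn F0)
    (x y z : C') (g g' : hom y z) (f : hom x y) (b : mor g g') :
  ⌈fmor (tf1 F) (b ▷ f)⌉ = rw (tf1 F f) ⌈fmor (tf1 F) b⌉.
Proof. by rewrite tf_hcompE; cells. Qed.

(** * Universal arrows from the values of [G] to [Delta] *)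

Section LeftAdjoint.
Context {C D E : TwoCat} (Delta : TwoFunctor D E) (G : TwoFunctor C E) (L0 : C -> D)
  (l : forall c, hom (G c) (Delta (L0 c))).

(** The fields are the clauses of [cat_isomorphismP] for the functor that applies [Delta] and
    whiskers with [l c], from [hom (L0 c) X] to [hom (G c) (Delta X)]. No 2-functoriality of [L0]
    enters. *)
Record left_universal : Prop := {
  luniv_sur : forall c X (m : hom (G c) (Delta X)),
    exists h : hom (L0 c) X, tf1 Delta h ∘ l c = m;
  luniv_inj : forall c X (h h' : hom (L0 c) X),
    tf1 Delta h ∘ l c = tf1 Delta h' ∘ l c -> h = h';
  luniv_full : forall c X (h h' : hom (L0 c) X)
      (r : mor (tf1 Delta h ∘ l c) (tf1 Delta h' ∘ l c)),
    exists a : mor h h', fmor (tf1 Delta) a ▷ l c = r;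
  luniv_faith : forall c X (h h' : hom (L0 c) X) (a b : mor h h'),
    fmor (tf1 Delta) a ▷ l c = fmor (tf1 Delta) b ▷ l c -> a = b
}.
Hypothesis Hl : left_universal.

(** Injectivity on 1-cells recovers the boundaries from the whiskered cells, so faithfulness applies
    to 2-cells not known to be parallel. *)
Lemma luniv_faith_cell (c : C) (X : D) (h k h' k' : hom (L0 c) X)
    (a : mor h k) (b : mor h' k') :
  rw (l c) ⌈fmor (tf1 Delta) a⌉ = rw (l c) ⌈fmor (tf1 Delta) b⌉ -> ⌈a⌉ = ⌈b⌉.
Proof.
move=> e; have p := luniv_inj Hl (cell_dom e); have q := luniv_inj Hl (cell_cod e).
case: h' / p b e; case: k' / q => b e; congr (cell _).
by apply: (luniv_faith Hl); apply: cell_inj.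
Qed.

Lemma luniv_full_cell (c : C) (X : D) (m m' : hom (G c) (Delta X)) (r : mor m m')
    (h h' : hom (L0 c) X) :
  tf1 Delta h ∘ l c = m -> tf1 Delta h' ∘ l c = m' ->
  exists a : mor h h', rw (l c) ⌈fmor (tf1 Delta) a⌉ = ⌈r⌉.
Proof.
move=> p q; case: (luniv_full Hl (castm (esym p) (esym q) r)) => a e.
by exists a; rewrite -cell_rw e cell_castm.
Qed.

Lemma luniv_iso (c : C) (X : D) (m m' : hom (G c) (Delta X)) (r : mor m m')
    (h h' : hom (L0 c) X) (a : mor h h') :
  rw (l c) ⌈fmor (tf1 Delta) a⌉ = ⌈r⌉ -> is_iso r -> is_iso a.
Proof.
move=> e [r' [r'r rr']].
have [b eb] := luniv_full_cell r' (cell_cod e) (cell_dom e).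
exists b; split; apply: cell_inj; apply: luniv_faith_cell; rewrite -!cell_rw; cells.
- by rewrite e eb -cell_comp r'r (cell_dom e).
- by rewrite e eb -cell_comp rr' (cell_cod e).
Qed.

Definition llift (c : C) (X : D) (m : hom (G c) (Delta X)) : hom (L0 c) X :=
  proj1_sig (constructive_indefinite_description _ (luniv_sur Hl m)).

Lemma lliftK (c : C) (X : D) (m : hom (G c) (Delta X)) : tf1 Delta (llift m) ∘ l c = m.
Proof. by rewrite /llift; case: constructive_indefinite_description. Qed.

Definition llift2 (c : C) (X : D) (m m' : hom (G c) (Delta X)) (r : mor m m') :
    mor (llift m) (llift m') :=
  proj1_sig (constructive_indefinite_description _
    (luniv_full_cell r (lliftK m) (lliftK m'))).

Lemma llift2K (c : C) (X : D) (m m' : hom (G c) (Delta X)) (r : mor m m') :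
  rw (l c) ⌈fmor (tf1 Delta) (llift2 r)⌉ = ⌈r⌉.
Proof. by rewrite /llift2; case: constructive_indefinite_description. Qed.

Program Definition llift_functor (c c' : C) : Functor (hom c c') (hom (L0 c) (L0 c')) :=
  {| fobj := fun f => llift (l c' ∘ tf1 G f);
     fmor := fun f f' a => llift2 (l c' ◁ fmor (tf1 G) a) |}.
Next Obligation.
apply: cell_inj; apply: luniv_faith_cell.
by rewrite llift2K -cell_rw; cells; rewrite lliftK.
Qed.
Next Obligation.
apply: cell_inj; apply: luniv_faith_cell.
by rewrite llift2K -cell_rw; cells; rewrite !llift2K.
Qed.

Lemma llift_functor1 (c c' : C) (f f' : hom c c') (a : mor f f') :
  rw (l c) ⌈fmor (tf1 Delta) (fmor (llift_functor c c') a)⌉ = lw (l c') ⌈fmor (tf1 G) a⌉.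
Proof. exact: llift2K. Qed.

(** After whiskering with the universal arrow, each 2-functor law becomes the corresponding law of
    [G]. Uniqueness of lifts then gives it strictly: [luniv_inj] for 1-cells, [luniv_faith_cell] for
    2-cells. *)
Program Definition left_functor : TwoFunctorOn L0 := {| tf1 := llift_functor |}.
Next Obligation.
by apply: (luniv_inj Hl); rewrite lliftK !tf_id1 comp1l comp1r.
Qed.
Next Obligation.
apply: (luniv_inj Hl); rewrite lliftK !tf_comp1 -[RHS]comp1A lliftK [RHS]comp1A lliftK.
exact: comp1A.
Qed.
Next Obligation.
apply: cell_inj; rewrite cell_eqml cell_eqmr; apply: luniv_faith_cell.
rewrite llift2K cell_lw (lw_split _ (tf_hcomp_cell _ _ _)).
rewrite (rw_split _ (tf_hcomp_cell _ _ _)) rw_lw llift_functor1 -rw_rw lliftK.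
by rewrite rw_rw llift_functor1 -!lw_lw lliftK rw_lw.
Qed.

(** The two equations are the 2-naturality of [l], on 1-cells and on 2-cells. What follows refers to
    [L] only through them, so the chosen lifts stay hidden. *)
Lemma left_functor_exists : exists L : TwoFunctorOn L0,
  (forall c c' (f : hom c c'), tf1 Delta (tf1 L f) ∘ l c = l c' ∘ tf1 G f) /\
  (forall c c' (f f' : hom c c') (a : mor f f'),
    rw (l c) ⌈fmor (tf1 Delta) (fmor (tf1 L) a)⌉ = lw (l c') ⌈fmor (tf1 G) a⌉).
Proof. by exists left_functor; split=> *; [exact: lliftK | exact: llift2K]. Qed.

Context (L1 : TwoFunctorOn L0)
  (Lnat : forall c c' (f : hom c c'), tf1 Delta (tf1 L1 f) ∘ l c = l c' ∘ tf1 G f)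
  (Lnat2 : forall c c' (f f' : hom c c') (a : mor f f'),
    rw (l c) ⌈fmor (tf1 Delta) (fmor (tf1 L1) a)⌉ = lw (l c') ⌈fmor (tf1 G) a⌉).
Let L : TwoFunctor C D := Build_TwoFunctor L1.

Section Mediating.
Context (M : TwoFunctor C D).

Section Existence.
Context (m : PseudoNat G (comp_2functor Delta M)).

Definition lmed0 (c : C) : hom (L c) (M c) := llift (m c).

Lemma lmed1_dom (c c' : C) (f : hom c c') :
  tf1 Delta (tf1 M f ∘ lmed0 c) ∘ l c = tf1 Delta (tf1 M f) ∘ m c.
Proof. by rewrite tf_comp1 -comp1A lliftK. Qed.

Lemma lmed1_cod (c c' : C) (f : hom c c') :
  tf1 Delta (lmed0 c' ∘ tf1 L f) ∘ l c = m c' ∘ tf1 G f.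
Proof. by rewrite tf_comp1 -comp1A Lnat comp1A lliftK. Qed.

Definition lmed1 (c c' : C) (f : hom c c') : mor (tf1 M f ∘ lmed0 c) (lmed0 c' ∘ tf1 L f) :=
  proj1_sig (constructive_indefinite_description _
    (luniv_full_cell (pn1 m f) (lmed1_dom f) (lmed1_cod f))).

Lemma lmed1K (c c' : C) (f : hom c c') :
  rw (l c) ⌈fmor (tf1 Delta) (lmed1 f)⌉ = ⌈pn1 m f⌉.
Proof. by rewrite /lmed1; case: constructive_indefinite_description. Qed.

(** The components of [m] lift objectwise. The source and target of [pn1 m f] are whiskerings of the
    wanted 1-cells, the target by 2-naturality of [l], so fullness lifts this 2-cell as well. The
    laws hold because after whiskering they are those of [m]. *)
Program Definition lmediating : PseudoNat L M := {| pn0 := lmed0; pn1 := lmed1 |}.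
Next Obligation. apply: (luniv_iso (lmed1K f)); exact: pn1_iso. Qed.
Next Obligation.
apply: cell_inj; apply: luniv_faith_cell; rewrite -!cell_rw; cells.
rewrite tf_rw_cell tf_lw_cell rw_lw Lnat2 -rw_rw lliftK !lmed1K -lw_lw lliftK.
by have := f_equal (@cell _ _ _) (pn_nat m a); cells.
Qed.
Next Obligation.
apply: cell_inj; apply: luniv_faith_cell; rewrite -!cell_rw; cells.
rewrite lmed1K; have := f_equal (@cell _ _ _) (pn_id m x); rewrite /=; cells => ->.
by rewrite tf_comp1 -comp1A lliftK !tf_id1.
Qed.
Next Obligation.
apply: cell_inj; apply: luniv_faith_cell; rewrite -!cell_rw; cells.
rewrite tf_rw_cell tf_lw_cell rw_lw !lmed1K -rw_rw Lnat rw_rw lmed1K.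
by have := f_equal (@cell _ _ _) (pn_comp m g f); rewrite /=; cells.
Qed.

Lemma lmediating0 (c : C) : tf1 Delta (lmediating c) ∘ l c = m c.
Proof. exact: lliftK. Qed.

Lemma lmediating1 (c c' : C) (f : hom c c') :
  rw (l c) ⌈fmor (tf1 Delta) (pn1 lmediating f)⌉ = ⌈pn1 m f⌉.
Proof. exact: lmed1K. Qed.
End Existence.

Lemma lmediating_unique (h h' : PseudoNat L M) :
  (forall c, tf1 Delta (h c) ∘ l c = tf1 Delta (h' c) ∘ l c) ->
  (forall c c' (f : hom c c'),
    rw (l c) ⌈fmor (tf1 Delta) (pn1 h f)⌉ = rw (l c) ⌈fmor (tf1 Delta) (pn1 h' f)⌉) ->
  h = h'.
Proof.
move=> e0 e1; apply: PseudoNat_cell_ext => [c|c c' f].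
- exact: (luniv_inj Hl).
- exact: luniv_faith_cell.
Qed.

(** The condition on [r] is the modification law between the transformations obtained by applying
    [Delta] to [h], [h'] and precomposing with [l]; the 2-cells of [l], being identities, do not
    appear. *)
Lemma lmediating_full (h h' : PseudoNat L M)
    (r : forall c, mor (tf1 Delta (h c) ∘ l c) (tf1 Delta (h' c) ∘ l c)) :
  (forall c c' (f : hom c c'),
    rw (l c) ⌈fmor (tf1 Delta) (pn1 h' f)⌉ ⊙ lw (tf1 Delta (tf1 M f)) ⌈r c⌉
    = rw (tf1 G f) ⌈r c'⌉ ⊙ rw (l c) ⌈fmor (tf1 Delta) (pn1 h f)⌉) ->
  exists a : Modification h h', forall c, fmor (tf1 Delta) (a c) ▷ l c = r c.
Proof.
move=> Hr.
have a c := constructive_indefinite_description _ (luniv_full Hl (r c)).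
have aK c : rw (l c) ⌈fmor (tf1 Delta) (proj1_sig (a c))⌉ = ⌈r c⌉.
  by case: (a c) => ? /= <-.
unshelve eexists; first unshelve eexists.
- by move=> c; exact: proj1_sig (a c).
- move=> c c' f; apply: cell_inj; apply: luniv_faith_cell; rewrite -!cell_rw; cells.
  rewrite tf_rw_cell tf_lw_cell rw_lw aK -rw_rw Lnat rw_rw aK; exact: Hr.
- by move=> c; apply: cell_inj; rewrite cell_rw aK.
Qed.
End Mediating.
End LeftAdjoint.

(** * Universal arrows from [Delta] to the values of [G] *)

Section RightAdjoint.
Context {C D E : TwoCat} (Delta : TwoFunctor D E) (G : TwoFunctor C E) (L0 : C -> D)
  (l : forall c, hom (Delta (L0 c)) (G c)).

Record right_universal : Prop := {
  runiv_sur : forall c X (m : hom (Delta X) (G c)),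
    exists h : hom X (L0 c), l c ∘ tf1 Delta h = m;
  runiv_inj : forall c X (h h' : hom X (L0 c)),
    l c ∘ tf1 Delta h = l c ∘ tf1 Delta h' -> h = h';
  runiv_full : forall c X (h h' : hom X (L0 c))
      (r : mor (l c ∘ tf1 Delta h) (l c ∘ tf1 Delta h')),
    exists a : mor h h', l c ◁ fmor (tf1 Delta) a = r;
  runiv_faith : forall c X (h h' : hom X (L0 c)) (a b : mor h h'),
    l c ◁ fmor (tf1 Delta) a = l c ◁ fmor (tf1 Delta) b -> a = b
}.
Hypothesis Hl : right_universal.

Lemma runiv_faith_cell (c : C) (X : D) (h k h' k' : hom X (L0 c))
    (a : mor h k) (b : mor h' k') :
  lw (l c) ⌈fmor (tf1 Delta) a⌉ = lw (l c) ⌈fmor (tf1 Delta) b⌉ -> ⌈a⌉ = ⌈b⌉.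
Proof.
move=> e; have p := runiv_inj Hl (cell_dom e); have q := runiv_inj Hl (cell_cod e).
case: h' / p b e; case: k' / q => b e; congr (cell _).
by apply: (runiv_faith Hl); apply: cell_inj.
Qed.

Lemma runiv_full_cell (c : C) (X : D) (m m' : hom (Delta X) (G c)) (r : mor m m')
    (h h' : hom X (L0 c)) :
  l c ∘ tf1 Delta h = m -> l c ∘ tf1 Delta h' = m' ->
  exists a : mor h h', lw (l c) ⌈fmor (tf1 Delta) a⌉ = ⌈r⌉.
Proof.
move=> p q; case: (runiv_full Hl (castm (esym p) (esym q) r)) => a e.
by exists a; rewrite -cell_lw e cell_castm.
Qed.

Lemma runiv_iso (c : C) (X : D) (m m' : hom (Delta X) (G c)) (r : mor m m')
    (h h' : hom X (L0 c)) (a : mor h h') :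
  lw (l c) ⌈fmor (tf1 Delta) a⌉ = ⌈r⌉ -> is_iso r -> is_iso a.
Proof.
move=> e [r' [r'r rr']].
have [b eb] := runiv_full_cell r' (cell_cod e) (cell_dom e).
exists b; split; apply: cell_inj; apply: runiv_faith_cell; rewrite -!cell_lw; cells.
- by rewrite e eb -cell_comp r'r (cell_dom e).
- by rewrite e eb -cell_comp rr' (cell_cod e).
Qed.

Definition rlift (c : C) (X : D) (m : hom (Delta X) (G c)) : hom X (L0 c) :=
  proj1_sig (constructive_indefinite_description _ (runiv_sur Hl m)).

Lemma rliftK (c : C) (X : D) (m : hom (Delta X) (G c)) : l c ∘ tf1 Delta (rlift m) = m.
Proof. by rewrite /rlift; case: constructive_indefinite_description. Qed.

Definition rlift2 (c : C) (X : D) (m m' : hom (Delta X) (G c)) (r : mor m m') :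
    mor (rlift m) (rlift m') :=
  proj1_sig (constructive_indefinite_description _
    (runiv_full_cell r (rliftK m) (rliftK m'))).

Lemma rlift2K (c : C) (X : D) (m m' : hom (Delta X) (G c)) (r : mor m m') :
  lw (l c) ⌈fmor (tf1 Delta) (rlift2 r)⌉ = ⌈r⌉.
Proof. by rewrite /rlift2; case: constructive_indefinite_description. Qed.

Program Definition rlift_functor (c c' : C) : Functor (hom c c') (hom (L0 c) (L0 c')) :=
  {| fobj := fun f => rlift (tf1 G f ∘ l c);
     fmor := fun f f' a => rlift2 (fmor (tf1 G) a ▷ l c) |}.
Next Obligation.
apply: cell_inj; apply: runiv_faith_cell.
by rewrite rlift2K -cell_lw; cells; rewrite rliftK.
Qed.
Next Obligation.
apply: cell_inj; apply: runiv_faith_cell.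
by rewrite rlift2K -cell_lw; cells; rewrite !rlift2K.
Qed.

Lemma rlift_functor1 (c c' : C) (f f' : hom c c') (a : mor f f') :
  lw (l c') ⌈fmor (tf1 Delta) (fmor (rlift_functor c c') a)⌉ = rw (l c) ⌈fmor (tf1 G) a⌉.
Proof. exact: rlift2K. Qed.

Program Definition right_functor : TwoFunctorOn L0 := {| tf1 := rlift_functor |}.
Next Obligation.
by apply: (runiv_inj Hl); rewrite rliftK !tf_id1 comp1l comp1r.
Qed.
Next Obligation.
apply: (runiv_inj Hl); rewrite rliftK !tf_comp1 [RHS]comp1A rliftK -[RHS]comp1A rliftK.
exact: esym (comp1A _ _ _).
Qed.
Next Obligation.
apply: cell_inj; rewrite cell_eqml cell_eqmr; apply: runiv_faith_cell.
rewrite rlift2K cell_rw (rw_split _ (tf_hcomp_cell _ _ _)).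
rewrite (lw_split _ (tf_hcomp_cell _ _ _)) -rw_lw rlift_functor1 -lw_lw rliftK.
by rewrite lw_lw rlift_functor1 -!rw_rw rliftK rw_lw.
Qed.

Lemma right_functor_exists : exists L : TwoFunctorOn L0,
  (forall c c' (f : hom c c'), l c' ∘ tf1 Delta (tf1 L f) = tf1 G f ∘ l c) /\
  (forall c c' (f f' : hom c c') (a : mor f f'),
    lw (l c') ⌈fmor (tf1 Delta) (fmor (tf1 L) a)⌉ = rw (l c) ⌈fmor (tf1 G) a⌉).
Proof. by exists right_functor; split=> *; [exact: rliftK | exact: rlift2K]. Qed.

Context (L1 : TwoFunctorOn L0)
  (Lnat : forall c c' (f : hom c c'), l c' ∘ tf1 Delta (tf1 L1 f) = tf1 G f ∘ l c)
  (Lnat2 : forall c c' (f f' : hom c c') (a : mor f f'),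
    lw (l c') ⌈fmor (tf1 Delta) (fmor (tf1 L1) a)⌉ = rw (l c) ⌈fmor (tf1 G) a⌉).
Let L : TwoFunctor C D := Build_TwoFunctor L1.

Section Mediating.
Context (M : TwoFunctor C D).

Section Existence.
Context (m : PseudoNat (comp_2functor Delta M) G).

Definition rmed0 (c : C) : hom (M c) (L c) := rlift (m c).

Lemma rmed1_dom (c c' : C) (f : hom c c') :
  l c' ∘ tf1 Delta (tf1 L f ∘ rmed0 c) = tf1 G f ∘ m c.
Proof. by rewrite tf_comp1 comp1A Lnat -comp1A rliftK. Qed.

Lemma rmed1_cod (c c' : C) (f : hom c c') :
  l c' ∘ tf1 Delta (rmed0 c' ∘ tf1 M f) = m c' ∘ tf1 Delta (tf1 M f).
Proof. by rewrite tf_comp1 comp1A rliftK. Qed.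

Definition rmed1 (c c' : C) (f : hom c c') : mor (tf1 L f ∘ rmed0 c) (rmed0 c' ∘ tf1 M f) :=
  proj1_sig (constructive_indefinite_description _
    (runiv_full_cell (pn1 m f) (rmed1_dom f) (rmed1_cod f))).

Lemma rmed1K (c c' : C) (f : hom c c') :
  lw (l c') ⌈fmor (tf1 Delta) (rmed1 f)⌉ = ⌈pn1 m f⌉.
Proof. by rewrite /rmed1; case: constructive_indefinite_description. Qed.

(** The 2-cell at [f] lies between 1-cells into [L c'], so it is lifted through and tested against
    the arrow [l c'] at the codomain of [f]; in the left-handed case it is the arrow at the
    domain. *)
Program Definition rmediating : PseudoNat M L := {| pn0 := rmed0; pn1 := rmed1 |}.
Next Obligation. apply: (runiv_iso (rmed1K f)); exact: pn1_iso. Qed.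
Next Obligation.
apply: cell_inj; apply: runiv_faith_cell; rewrite -!cell_lw; cells.
rewrite tf_rw_cell tf_lw_cell -rw_lw Lnat2 -rw_rw rliftK !rmed1K -lw_lw rliftK.
by have := f_equal (@cell _ _ _) (pn_nat m a); cells.
Qed.
Next Obligation.
apply: cell_inj; apply: runiv_faith_cell; rewrite -!cell_lw; cells.
rewrite rmed1K; have := f_equal (@cell _ _ _) (pn_id m x); rewrite /=; cells => ->.
by rewrite tf_comp1 comp1A tf_id1 comp1r rliftK ?comp1l.
Qed.
Next Obligation.
apply: cell_inj; apply: runiv_faith_cell; rewrite -!cell_lw; cells.
rewrite tf_rw_cell tf_lw_cell -rw_lw !rmed1K -lw_lw Lnat lw_lw rmed1K.
by have := f_equal (@cell _ _ _) (pn_comp m g f); rewrite /=; cells.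
Qed.

Lemma rmediating0 (c : C) : l c ∘ tf1 Delta (rmediating c) = m c.
Proof. exact: rliftK. Qed.

Lemma rmediating1 (c c' : C) (f : hom c c') :
  lw (l c') ⌈fmor (tf1 Delta) (pn1 rmediating f)⌉ = ⌈pn1 m f⌉.
Proof. exact: rmed1K. Qed.
End Existence.

Lemma rmediating_unique (h h' : PseudoNat M L) :
  (forall c, l c ∘ tf1 Delta (h c) = l c ∘ tf1 Delta (h' c)) ->
  (forall c c' (f : hom c c'),
    lw (l c') ⌈fmor (tf1 Delta) (pn1 h f)⌉ = lw (l c') ⌈fmor (tf1 Delta) (pn1 h' f)⌉) ->
  h = h'.
Proof.
move=> e0 e1; apply: PseudoNat_cell_ext => [c|c c' f].
- exact: (runiv_inj Hl).
- exact: runiv_faith_cell.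
Qed.

Lemma rmediating_full (h h' : PseudoNat M L)
    (r : forall c, mor (l c ∘ tf1 Delta (h c)) (l c ∘ tf1 Delta (h' c))) :
  (forall c c' (f : hom c c'),
    lw (l c') ⌈fmor (tf1 Delta) (pn1 h' f)⌉ ⊙ lw (tf1 G f) ⌈r c⌉
    = rw (tf1 Delta (tf1 M f)) ⌈r c'⌉ ⊙ lw (l c') ⌈fmor (tf1 Delta) (pn1 h f)⌉) ->
  exists a : Modification h h', forall c, l c ◁ fmor (tf1 Delta) (a c) = r c.
Proof.
move=> Hr.
have a c := constructive_indefinite_description _ (runiv_full Hl (r c)).
have aK c : lw (l c) ⌈fmor (tf1 Delta) (proj1_sig (a c))⌉ = ⌈r c⌉.
  by case: (a c) => ? /= <-.
unshelve eexists; first unshelve eexists.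
- by move=> c; exact: proj1_sig (a c).
- move=> c c' f; apply: cell_inj; apply: runiv_faith_cell; rewrite -!cell_lw; cells.
  rewrite tf_rw_cell tf_lw_cell -rw_lw aK -lw_lw Lnat lw_lw aK; exact: Hr.
- by move=> c; apply: cell_inj; rewrite cell_lw aK.
Qed.
End Mediating.
End RightAdjoint.

Local Obligation Tactic := intros.

(** * Transposition *)

Section Transposition.
Context {C D I : TwoCat} (F : PseudoFunctor I (Hom_p C D)).
Local Notation nat u := (pf1 F u : PseudoNat (pf0 F _) (pf0 F _)).
Local Notation md2 a := (fmor (pf1 F) a : Modification _ _).
Local Notation mdid i := (pf_id F i : Modification _ _).
Local Notation mdcomp v u := (pf_comp F v u : Modification _ _).

Definition str (i j : I) (u : hom i j) (c c' : C) (f : hom c c') :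
    mor (tf1 (F j) f ∘ nat u c) (nat u c' ∘ tf1 (F i) f) :=
  pn1 (nat u) f.

Definition str_iso (i j : I) (u : hom i j) (c c' : C) (f : hom c c') :
    is_iso (str u f) :=
  pn1_iso (nat u) f.

(** Exchanging [u] and [f] reverses the square: a transformation with components [tf1 (F i) f] must
    have at [u] a 2-cell from [nat u c' ∘ tf1 (F i) f] to [tf1 (F j) f ∘ nat u c], opposite to
    [str u f]. *)
Definition istr (i j : I) (u : hom i j) (c c' : C) (f : hom c c') := inv (str_iso u f).

Lemma str_id (i j : I) (u : hom i j) (c : C) :
  ⌈str u (id1 c)⌉ = ⌈idm (id1 (F j c) ∘ nat u c)⌉.
Proof. have := f_equal (@cell _ _ _) (pn_id (nat u) c); by rewrite /=; cells. Qed.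

Lemma str_comp (i j : I) (u : hom i j) (c c' c'' : C) (g : hom c' c'') (f : hom c c') :
  ⌈str u (g ∘ f)⌉ = rw (tf1 (F i) f) ⌈str u g⌉ ⊙ lw (tf1 (F j) g) ⌈str u f⌉.
Proof. have := f_equal (@cell _ _ _) (pn_comp (nat u) g f); by rewrite /=; cells. Qed.

(** The laws of [pf1 F u] as a transformation in [c] ([istr_id], [istr_comp], [istr_nat]) become the
    functoriality of the transpose in [f] and the modification law of [transpose2]. *)
Lemma istr_id (i j : I) (u : hom i j) (c : C) : ⌈istr u (id1 c)⌉ = ⌈idm (nat u c)⌉.
Proof.
apply: (inv_unique _ (z := nat u c)); first by rewrite tf_id1 comp1r.
by rewrite str_id vcomp_unitl // comp1l.
Qed.

Lemma istr_comp (i j : I) (u : hom i j) (c c' c'' : C) (g : hom c' c'') (f : hom c c') :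
  ⌈istr u (g ∘ f)⌉ = lw (tf1 (F j) g) ⌈istr u f⌉ ⊙ rw (tf1 (F i) f) ⌈istr u g⌉.
Proof.
apply: (inv_unique _ (z := nat u c'' ∘ tf1 (F i) g ∘ tf1 (F i) f)).
  by rewrite tf_comp1 comp1A.
rewrite str_comp vcompA -[lw _ _ ⊙ lw _ _ ⊙ _]vcompA lw_invr.
rewrite -cell_rw vcomp_unitl ?comp1A // cell_rw; exact: rw_invr.
Qed.

Lemma istr_nat (i j : I) (u : hom i j) (c c' : C) (f f' : hom c c') (a : mor f f') :
  rw (nat u c) ⌈fmor (tf1 (F j)) a⌉ ⊙ ⌈istr u f⌉
  = ⌈istr u f'⌉ ⊙ lw (nat u c') ⌈fmor (tf1 (F i)) a⌉.
Proof.
have e := inv_square (str_iso u f) (str_iso u f') (pn_nat (nat u) a).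
by have := f_equal (@cell _ _ _) e; rewrite /=; cells.
Qed.

(** Conversely, that [F] sends 2-cells to modifications and has modifications as comparison cells
    ([istr_mod], [istr_pf_id], [istr_pf_comp]) provides the three pseudo-naturality laws of
    [transpose1 f]. *)
Lemma istr_mod (i j : I) (u u' : hom i j) (a : mor u u') (c c' : C) (f : hom c c') :
  ⌈istr u' f⌉ ⊙ rw (tf1 (F i) f) ⌈md2 a c'⌉ = lw (tf1 (F j) f) ⌈md2 a c⌉ ⊙ ⌈istr u f⌉.
Proof.
have e := inv_square (str_iso u f) (str_iso u' f) (md_nat (md2 a) f).
by have := f_equal (@cell _ _ _) e; rewrite /=; cells.
Qed.

Lemma istr_pf_id (i : I) (c c' : C) (f : hom c c') :
  ⌈istr (id1 i) f⌉ ⊙ rw (tf1 (F i) f) ⌈mdid i c'⌉ = lw (tf1 (F i) f) ⌈mdid i c⌉.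
Proof.
have := f_equal (@cell _ _ _) (md_nat (mdid i) f); rewrite /=; cells.
by move=> e; apply: esym (vcompVK (str_iso (id1 i) f) e _); rewrite e.
Qed.

Lemma str_pf_comp (i j k : I) (v : hom j k) (u : hom i j) (c c' : C) (f : hom c c') :
  ⌈str (v ∘ u) f⌉ ⊙ lw (tf1 (F k) f) ⌈mdcomp v u c⌉
  = rw (tf1 (F i) f) ⌈mdcomp v u c'⌉ ⊙ lw (nat v c') ⌈str u f⌉ ⊙ rw (nat u c) ⌈str v f⌉.
Proof. by have := f_equal (@cell _ _ _) (md_nat (mdcomp v u) f); rewrite /=; cells. Qed.

Lemma istr_pf_comp (i j k : I) (v : hom j k) (u : hom i j) (c c' : C) (f : hom c c') :
  ⌈istr (v ∘ u) f⌉ ⊙ rw (tf1 (F i) f) ⌈mdcomp v u c'⌉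
  = lw (tf1 (F k) f) ⌈mdcomp v u c⌉ ⊙ rw (nat u c) ⌈istr v f⌉ ⊙ lw (nat v c') ⌈istr u f⌉.
Proof.
have ne : ⌈str (v ∘ u) f⌉ ⊙ lw (tf1 (F k) f) ⌈mdcomp v u c⌉ <> None.
  by move: (cell_comp (str (v ∘ u) f) (tf1 (F k) f ◁ mdcomp v u c)); rewrite cell_lw => <-.
have e := vcompVK (str_iso (v ∘ u) f) (str_pf_comp v u f) ne.
(* The comparison cell at [c] is replaced by its expression through the one at [c']; then the
   2-cells of [v] cancel against their inverses, and after them those of [u]. *)
apply: etrans (f_equal (fun b => b ⊙ _) (esym e)); rewrite !vcompA.
congr (_ ⊙ _).
rewrite -[rw _ _ ⊙ rw _ _ ⊙ _]vcompA rw_invr -[lw _ ⌈istr u f⌉]cell_lw.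
rewrite vcomp_unitl ?comp1A // cell_lw lw_invr -cell_rw vcomp_unitr //=.
by rewrite comp1A.
Qed.

Program Definition transpose1 (c c' : C) (f : hom c c') :
    PseudoNat (comp_2functor (ev_p D c) F) (comp_2functor (ev_p D c') F) :=
  {| pn0 := fun i => tf1 (F i) f; pn1 := fun i j u => istr u f |}.
Next Obligation. exact: inv_iso. Qed.
Next Obligation. apply: cell_inj; cells; exact: istr_mod. Qed.
Next Obligation. apply: cell_inj; cells; exact: istr_pf_id. Qed.
Next Obligation. apply: cell_inj; cells; exact: istr_pf_comp. Qed.

Program Definition transpose2 (c c' : C) (f f' : hom c c') (a : mor f f') :
    Modification (transpose1 f) (transpose1 f') :=
  {| md := fun i => fmor (tf1 (F i)) a |}.
Next Obligation. apply: cell_inj; cells; exact: esym (istr_nat _ _). Qed.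

Program Definition transpose_functor (c c' : C) :
    Functor (hom c c')
      (PseudoNatCat (comp_2functor (ev_p D c) F) (comp_2functor (ev_p D c') F)) :=
  {| fobj := @transpose1 c c'; fmor := @transpose2 c c' |}.
Next Obligation. apply: Modification_ext => i; exact: fmor_id. Qed.
Next Obligation. apply: Modification_ext => i; exact: fmor_comp. Qed.

Lemma transpose1_id (c : C) : transpose1 (id1 c) = id_pseudonat _.
Proof.
apply: PseudoNat_cell_ext => [i|i j u]; first exact (tf_id1 (F i) c).
by rewrite /= istr_id; cells; rewrite comp1r.
Qed.

Lemma transpose1_comp (c c' c'' : C) (g : hom c' c'') (f : hom c c') :
  transpose1 (g ∘ f) = comp_pseudonat (transpose1 g) (transpose1 f).
Proof.
apply: PseudoNat_cell_ext => [i|i j u]; first exact (tf_comp1 (F i) g f).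
by rewrite /= istr_comp; cells.
Qed.

Program Definition transpose_on :
    TwoFunctorOn (D := PseudoFun I D) (fun c : C => comp_2functor (ev_p D c) F) :=
  {| tf1 := transpose_functor; tf_id1 := transpose1_id; tf_comp1 := transpose1_comp |}.
Next Obligation.
apply: cell_inj; rewrite cell_eqml cell_eqmr.
apply: Modification_cell_ext => [||i]; try exact: transpose1_comp.
by rewrite /= tf_hcompE cell_eqml cell_eqmr.
Qed.

Definition transpose : TwoFunctor C (PseudoFun I D) := Build_TwoFunctor transpose_on.
End Transposition.

Program Definition strict_pseudonat (C D : TwoCat) (F G : TwoFunctor C D)
    (s : forall c, hom (F c) (G c))
    (e : forall c c' (f : hom c c'), tf1 G f ∘ s c = s c' ∘ tf1 F f)
    (n : forall c c' (f f' : hom c c') (a : mor f f'),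
      rw (s c) ⌈fmor (tf1 G) a⌉ = lw (s c') ⌈fmor (tf1 F) a⌉) : PseudoNat F G :=
  {| pn0 := s; pn1 := fun c c' f => eqm (e c c' f) |}.
Next Obligation. exact: eqm_iso. Qed.
Next Obligation. apply: cell_inj; rewrite /=; cells; exact: n. Qed.
Next Obligation. by nf; eqs. Qed.
Next Obligation. by nf; eqs. Qed.

Program Definition diagonal_functor (I D : TwoCat) (X Y : D) :
    Functor (hom X Y) (PseudoNatCat (const_2functor I X) (const_2functor I Y)) :=
  {| fobj := @const_pseudonat I D X Y; fmor := @const_modification I D X Y |}.
Next Obligation. exact: Modification_ext. Qed.
Next Obligation. exact: Modification_ext. Qed.

Lemma const_pseudonat_id (I D : TwoCat) (X : D) :
  const_pseudonat I (id1 X) = id_pseudonat (const_2functor I X).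
Proof. by apply: PseudoNat_cell_ext => // i j u; rewrite /=; cells. Qed.

Lemma const_pseudonat_comp (I D : TwoCat) (X Y Z : D) (g : hom Y Z) (f : hom X Y) :
  const_pseudonat I (g ∘ f) = comp_pseudonat (const_pseudonat I g) (const_pseudonat I f).
Proof. by apply: PseudoNat_cell_ext => // i j u; rewrite /=; cells. Qed.

Program Definition diagonal_on (I D : TwoCat) :
    TwoFunctorOn (D := PseudoFun I D) (fun X : D => const_2functor I X) :=
  {| tf1 := @diagonal_functor I D; tf_id1 := @const_pseudonat_id I D;
     tf_comp1 := @const_pseudonat_comp I D |}.
Next Obligation.
apply: cell_inj; rewrite cell_eqml cell_eqmr.
by apply: Modification_cell_ext => //; exact: const_pseudonat_comp.
Qed.

Definition diagonal (I D : TwoCat) : TwoFunctor D (PseudoFun I D) :=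
  Build_TwoFunctor (diagonal_on I D).

(** Componentwise inverses satisfy the modification law automatically, by cancelling the components
    of [r] on both sides of its own law. *)
Lemma is_iso_modification (C D : TwoCat) (F G : PseudoFunctor C D)
    (s t : PseudoNatCat F G) (r : mor s t) :
  (forall x, is_iso (md r x)) -> is_iso r.
Proof.
move=> ir.
have nat x y (f : hom x y) : pn1 (s : PseudoNat F G) f • (pf1 G f ◁ inv (ir x))
    = (inv (ir y) ▷ pf1 F f) • pn1 (t : PseudoNat F G) f.
  rewrite -[LHS]compm1l -hcomp_id -(invl (ir y)) rw_comp -compmA (compmA (_ ▷ _) (pn1 _ _)).
  by rewrite -md_nat -(compmA (pn1 _ _)) -lw_comp invr hcomp_id compm1r.
exists {| md := fun x => inv (ir x); md_nat := nat |}.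
by split; apply: Modification_ext => x; [exact: invl | exact: invr].
Qed.

Lemma comp_pseudonat_cell (C D : TwoCat) (F G H : PseudoFunctor C D)
    (t : PseudoNat G H) (s : PseudoNat F G) (x y : C) (f : hom x y) :
  ⌈pn1 (comp_pseudonat t s) f⌉ = lw (t y) ⌈pn1 s f⌉ ⊙ rw (s x) ⌈pn1 t f⌉.
Proof. by rewrite /=; cells. Qed.

Lemma id_comp_cell (C D : TwoCat) (F G : PseudoFunctor C D) (s : PseudoNat F G)
    (x y : C) (f : hom x y) :
  ⌈pn1 (comp_pseudonat (id_pseudonat G) s) f⌉ = ⌈pn1 s f⌉.
Proof. by rewrite comp_pseudonat1l. Qed.

Lemma image_cone_cell (I B B' : TwoCat) (G : TwoFunctor B B') (F : PseudoFunctor I B)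
    (X : B) (l : PseudoCone F X) (i j : I) (u : hom i j) :
  ⌈pn1 (image_cone G l) u⌉ = ⌈fmor (tf1 G) (pn1 l u)⌉.
Proof. by rewrite /=; cells. Qed.

Lemma const_comp_cell (I D : TwoCat) (G : PseudoFunctor I D) (X Y : D) (h : hom X Y)
    (l : PseudoCone G X) (i j : I) (u : hom i j) :
  ⌈pn1 (comp_pseudonat (const_pseudonat I h) l) u⌉ = lw h ⌈pn1 l u⌉.
Proof. by rewrite /=; cells. Qed.

Lemma comp_2functor_id_cell (I B B' : TwoCat) (G : TwoFunctor B B')
    (F : PseudoFunctor I B) (i : I) :
  ⌈pf_id (comp_2functor G F) i⌉ = ⌈fmor (tf1 G) (pf_id F i)⌉.
Proof. exact: cell_eqmr. Qed.

Lemma comp_2functor_comp_cell (I B B' : TwoCat) (G : TwoFunctor B B')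
    (F : PseudoFunctor I B) (i j k : I) (v : hom j k) (u : hom i j) :
  ⌈pf_comp (comp_2functor G F) v u⌉ = ⌈fmor (tf1 G) (pf_comp F v u)⌉.
Proof. exact: cell_eqmr. Qed.

(** * The laws of a pseudo-cone as equations between cells *)

Section ConeLaws.
Context {I B : TwoCat} (G : PseudoFunctor I B) {X : B} (l : PseudoCone G X).

Lemma cone_nat (i j : I) (u u' : hom i j) (a : mor u u') :
  ⌈pn1 l u'⌉ = lw (l j) ⌈fmor (pf1 G) a⌉ ⊙ ⌈pn1 l u⌉.
Proof. by have := f_equal (@cell _ _ _) (pn_nat l a); cells. Qed.

Lemma cone_id (i : I) : ⌈pn1 l (id1 i)⌉ = lw (l i) ⌈pf_id G i⌉.
Proof. by have := f_equal (@cell _ _ _) (pn_id l i); cells. Qed.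

Lemma cone_comp (i j k : I) (v : hom j k) (u : hom i j) :
  ⌈pn1 l (v ∘ u)⌉ = lw (l k) ⌈pf_comp G v u⌉ ⊙ rw (pf1 G u) ⌈pn1 l v⌉ ⊙ ⌈pn1 l u⌉.
Proof. by have := f_equal (@cell _ _ _) (pn_comp l v u); cells. Qed.
End ConeLaws.

(** * Pseudo-cones in [Hom_p] and their transposes *)

Section HomCones.
Context {C D I : TwoCat} (F : PseudoFunctor I (Hom_p C D)).
Local Notation nat u := (pf1 F u : PseudoNat (pf0 F _) (pf0 F _)).
Local Notation md2 a := (fmor (pf1 F) a : Modification _ _).
Local Notation mdid i := (pf_id F i : Modification _ _).
Local Notation mdcomp v u := (pf_comp F v u : Modification _ _).

Section Cone.
Context {M : TwoFunctor C D} (m0 : forall i, PseudoNat (F i) M)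
  (m1 : forall i j (u : hom i j) (c : C), mor (id1 (M c) ∘ m0 i c) (m0 j c ∘ nat u c)).
Arguments m1 {i j} u c.
Context
  (m1_iso : forall i j (u : hom i j) (c : C), is_iso (m1 u c))
  (m1_mod : forall i j (u : hom i j) (c c' : C) (f : hom c c'),
    lw (m0 j c') ⌈pn1 (nat u) f⌉ ⊙ rw (nat u c) ⌈pn1 (m0 j) f⌉ ⊙ lw (tf1 M f) ⌈m1 u c⌉
    = rw (tf1 (F i) f) ⌈m1 u c'⌉ ⊙ ⌈pn1 (m0 i) f⌉)
  (m1_nat : forall i j (u u' : hom i j) (a : mor u u') (c : C),
    ⌈m1 u' c⌉ = lw (m0 j c) ⌈md2 a c⌉ ⊙ ⌈m1 u c⌉)
  (m1_id : forall i c, ⌈m1 (id1 i) c⌉ = lw (m0 i c) ⌈mdid i c⌉)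
  (m1_comp : forall i j k (v : hom j k) (u : hom i j) (c : C),
    ⌈m1 (v ∘ u) c⌉ = lw (m0 k c) ⌈mdcomp v u c⌉ ⊙ rw (nat u c) ⌈m1 v c⌉ ⊙ ⌈m1 u c⌉).

Program Definition homp_cone_mod (i j : I) (u : hom i j) :
    Modification (comp_pseudonat (id_pseudonat M) (m0 i)) (comp_pseudonat (m0 j) (nat u)) :=
  {| md := m1 u |}.
Next Obligation.
apply: cell_inj; rewrite [LHS]cell_comp [RHS]cell_comp comp_pseudonat_cell id_comp_cell.
rewrite vcompA cell_lw cell_rw; exact: m1_mod.
Qed.

(** The data separate by index: for fixed [c], [m1_nat], [m1_id] and [m1_comp] are the laws of a
    pseudo-cone in [D], while [m1_mod] says that for fixed [u] the 2-cells form a modification in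
    [c]. *)
Program Definition homp_cone : PseudoCone F (M : Hom_p C D) :=
  {| pn0 := m0; pn1 := homp_cone_mod |}.
Next Obligation. apply: is_iso_modification => c; exact: m1_iso. Qed.
Next Obligation.
apply: Modification_ext => c; apply: cell_inj; rewrite /=; cells; exact: m1_nat.
Qed.
Next Obligation.
apply: Modification_ext => c; apply: cell_inj; rewrite /= !eqm_md /=; cells; exact: m1_id.
Qed.
Next Obligation.
apply: Modification_ext => c; apply: cell_inj; rewrite /= !eqm_md /=; cells; exact: m1_comp.
Qed.
End Cone.

Section StrictCone.
Context {M : TwoFunctor C D} (s0 : forall (c : C) (i : I), hom (F i c) (M c)).
Arguments s0 : clear implicits.
Context (e : forall i c c' (f : hom c c'), tf1 M f ∘ s0 c i = s0 c' i ∘ tf1 (F i) f)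
  (n : forall i c c' (f f' : hom c c') (a : mor f f'),
    rw (s0 c i) ⌈fmor (tf1 M) a⌉ = lw (s0 c' i) ⌈fmor (tf1 (F i)) a⌉)
  (m1 : forall c i j (u : hom i j), mor (id1 (M c) ∘ s0 c i) (s0 c j ∘ nat u c)).
Arguments m1 c {i j} u.

(** The premise is the equality of pseudo-cones expressing naturality of the family in [c], read at
    the 1-cell [u]; cancelling [istr F u f] against [pn1 (nat u) f] turns it into the modification
    law. *)
Lemma strict_homp_cone_mod :
  (forall i j (u : hom i j) c c' (f : hom c c'),
    lw (tf1 M f) ⌈m1 c u⌉ = lw (s0 c' j) ⌈istr F u f⌉ ⊙ rw (tf1 (F i) f) ⌈m1 c' u⌉) ->
  forall i j (u : hom i j) c c' (f : hom c c'),
    lw (s0 c' j) ⌈pn1 (nat u) f⌉ ⊙ rw (nat u c) ⌈pn1 (strict_pseudonat (e j) (n j)) f⌉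
      ⊙ lw (tf1 M f) ⌈m1 c u⌉
    = rw (tf1 (F i) f) ⌈m1 c' u⌉ ⊙ ⌈pn1 (strict_pseudonat (e i) (n i)) f⌉.
Proof.
move=> H i j u c c' f.
rewrite /= !cell_eqm rw_idm -[lw _ ⌈m1 c u⌉]cell_lw vcomp_unitl ?comp1A // cell_lw.
rewrite -[rw _ ⌈m1 c' u⌉]cell_rw vcomp_unitr ?comp1l // cell_rw.
by rewrite H -vcompA lw_invr -cell_rw vcomp_unitl ?comp1A.
Qed.
End StrictCone.

Section Components.
Context {M : TwoFunctor C D} (m : PseudoCone F (M : Hom_p C D)).
Local Notation m0 := (fun i => m i : PseudoNat (F i) M).
Local Notation m1 u := (pn1 m u : Modification _ _).

Lemma homp_cone_modE (i j : I) (u : hom i j) (c c' : C) (f : hom c c') :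
  lw (m0 j c') ⌈pn1 (nat u) f⌉ ⊙ rw (nat u c) ⌈pn1 (m0 j) f⌉ ⊙ lw (tf1 M f) ⌈m1 u c⌉
  = rw (tf1 (F i) f) ⌈m1 u c'⌉ ⊙ ⌈pn1 (m0 i) f⌉.
Proof.
have := md_nat_cell (m1 u) f.
by rewrite comp_pseudonat_cell id_comp_cell vcompA.
Qed.

Lemma ev_cone_cell (i j : I) (u : hom i j) (c : C) :
  ⌈pn1 (image_cone (ev_p D c) m) u⌉ = ⌈m1 u c⌉.
Proof. exact: image_cone_cell. Qed.

Lemma transpose_cone_mod (i j : I) (u : hom i j) (c c' : C) (f : hom c c') :
  lw (m0 j c') ⌈istr F u f⌉ ⊙ rw (tf1 (F i) f) ⌈m1 u c'⌉ ⊙ ⌈pn1 (m0 i) f⌉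
  = rw (nat u c) ⌈pn1 (m0 j) f⌉ ⊙ lw (tf1 M f) ⌈m1 u c⌉.
Proof.
rewrite -homp_cone_modE -[lw _ _ ⊙ lw _ _ ⊙ _]vcompA lw_invl.
by rewrite -vcompA -[rw (nat u c) _]cell_rw vcomp_unitl // comp1A.
Qed.

Program Definition transpose_cone1 (c c' : C) (f : hom c c') :
    Modification
      (comp_pseudonat (const_pseudonat I (tf1 M f)) (image_cone (ev_p D c) m))
      (comp_pseudonat (image_cone (ev_p D c') m) (transpose1 F f)) :=
  {| md := fun i => pn1 (m0 i) f |}.
Next Obligation.
apply: cell_inj; rewrite [LHS]cell_comp [RHS]cell_comp const_comp_cell comp_pseudonat_cell.
rewrite !ev_cone_cell /= cell_lw cell_rw lw_id vcompA; exact: transpose_cone_mod.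
Qed.

(** The cone laws of [m] are absorbed into the components, which are the evaluated cones; the laws
    still to be checked are, at each [i], those of the pseudo-natural transformation [m i]. *)
Program Definition transpose_cone :
    PseudoNat (transpose F) (comp_2functor (diagonal I D) M) :=
  {| pn0 := fun c => image_cone (ev_p D c) m; pn1 := transpose_cone1 |}.
Next Obligation. apply: is_iso_modification => i; exact: (pn1_iso (m0 i)). Qed.
Next Obligation.
apply: Modification_ext => i; apply: cell_inj.
have := f_equal (@cell _ _ _) (pn_nat (m0 i) a).
by [].
Qed.
Next Obligation.
apply: Modification_ext => i; apply: cell_inj.
have := f_equal (@cell _ _ _) (pn_id (m0 i) x).
by rewrite /= !eqm_md /=; cells.
Qed.
Next Obligation.
apply: Modification_ext => i; apply: cell_inj.
have := f_equal (@cell _ _ _) (pn_comp (m0 i) g f).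
by rewrite /= !eqm_md /=; cells.
Qed.
End Components.
End HomCones.

(** * Pseudo-colimits in [Hom_p] *)

Section Colimits.
Context {C D I : TwoCat} (F : PseudoFunctor I (Hom_p C D)) (L0 : C -> D)
  (l : forall c : C, PseudoCone (comp_2functor (ev_p D c) F) (L0 c)).
Local Notation nat u := (pf1 F u : PseudoNat (pf0 F _) (pf0 F _)).
Local Notation lE c := (l c : hom (transpose F c) (diagonal I D (L0 c))).
Hypothesis Hl : forall c, is_pseudocolimit (l c).

(** Whiskering with [l c] after the diagonal is definitionally [precomp_cone (l c)], so the fields
    are the clauses of [cat_isomorphismP]. *)
Lemma pseudocolimit_universal :
  left_universal (Delta := diagonal I D) (G := transpose F) l.
Proof. by split=> c X; have /cat_isomorphismP [] := Hl c X. Qed.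

Context (L1 : TwoFunctorOn L0)
  (Lnat : forall c c' (f : hom c c'),
    tf1 (diagonal I D) (tf1 L1 f) ∘ lE c = lE c' ∘ tf1 (transpose F) f)
  (Lnat2 : forall c c' (f f' : hom c c') (a : mor f f'),
    rw (lE c) ⌈fmor (tf1 (diagonal I D)) (fmor (tf1 L1) a)⌉
    = lw (lE c') ⌈fmor (tf1 (transpose F)) a⌉).
Let L : TwoFunctor C D := Build_TwoFunctor L1.

(** [Lnat] is an equality between transformations in [i]. Its components give the naturality of each
    coprojection, and its 2-cells at [u] ([colim_nat1]) give the modification law for the 2-cells of
    the cone. *)
Lemma colim_nat0 (i : I) (c c' : C) (f : hom c c') :
  tf1 L f ∘ l c i = l c' i ∘ tf1 (F i) f.
Proof. exact: (f_equal (fun s : PseudoNat _ _ => s i) (Lnat f)). Qed.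

Lemma colim_nat1 (i j : I) (u : hom i j) (c c' : C) (f : hom c c') :
  lw (tf1 L f) ⌈pn1 (l c) u⌉ = lw (l c' j) ⌈istr F u f⌉ ⊙ rw (tf1 (F i) f) ⌈pn1 (l c') u⌉.
Proof.
have := f_equal (fun s : PseudoNat _ _ => ⌈pn1 s u⌉) (Lnat f).
by rewrite const_comp_cell comp_pseudonat_cell.
Qed.

Lemma colim_nat2 (i : I) (c c' : C) (f f' : hom c c') (a : mor f f') :
  rw (l c i) ⌈fmor (tf1 L) a⌉ = lw (l c' i) ⌈fmor (tf1 (F i)) a⌉.
Proof. have := Lnat2 a; rewrite -cell_lw -cell_rw; exact: (cell_md i). Qed.

Definition colim0 (i : I) : PseudoNat (F i) L :=
  strict_pseudonat (colim_nat0 i) (colim_nat2 i).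

Program Definition colim_cone : PseudoCone F (L : Hom_p C D) :=
  homp_cone (m0 := colim0) (m1 := fun i j u c => pn1 (l c) u) _ _ _ _ _.
Next Obligation. exact: (pn1_iso (l c)). Qed.
Next Obligation.
exact (strict_homp_cone_mod colim_nat0 colim_nat2
  (m1 := fun c i j u => pn1 (l c) u) (fun i j u c c' f => colim_nat1 u f) u f).
Qed.
Next Obligation. exact: (cone_nat (l c)). Qed.
Next Obligation.
apply: etrans (cone_id (l c) i) _; rewrite comp_2functor_id_cell; exact: erefl.
Qed.
Next Obligation.
apply: etrans (cone_comp (l c) v u) _; rewrite comp_2functor_comp_cell; exact: erefl.
Qed.

Section Vertex.
Context (M : TwoFunctor C D).

(** This identifies the whiskering by which the universal arrow tests 2-cells with composition with
    the cone inside [Hom_p]; the coprojections contribute only identities. *)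
Lemma colim_whisker (h : PseudoNat L M) (i : I) (c c' : C) (f : hom c c') :
  ⌈pn1 (comp_pseudonat h (colim0 i)) f⌉ = rw (l c i) ⌈pn1 h f⌉.
Proof.
rewrite comp_pseudonat_cell /= cell_eqm lw_idm -cell_rw vcomp_unitl //.
exact: comp1A.
Qed.

Lemma colim_post (h : PseudoNat L M) (i j : I) (u : hom i j) (c : C) :
  ⌈md (pn1 (precomp_cone colim_cone (M : Hom_p C D) h) u) c⌉ = lw (h c) ⌈pn1 (l c) u⌉.
Proof.
have e := const_comp_cell (h : hom (L : Hom_p C D) M) colim_cone u.
exact: (cell_md c e).
Qed.

Lemma precomp_colim0 (h : PseudoNat L M) (i : I) :
  pn0 (precomp_cone colim_cone (M : Hom_p C D) h) i = comp_pseudonat h (colim0 i).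
Proof. by []. Qed.

Lemma colim_lE (c : C) (X : D) (h h' : hom (L0 c) X) (a : mor h h') (i : I) :
  ⌈md (fmor (tf1 (diagonal I D)) a ▷ lE c) i⌉ = rw (l c i) ⌈a⌉.
Proof. by []. Qed.

(** Transposing back distributes the information: [lmed0] read at [i] and at [u] recovers the
    components of [m] and its cone 2-cells, and [lmed1] read at [i] recovers the pseudo-naturality
    2-cells of [m i]. *)
Lemma colim_sur (m : PseudoCone F (M : Hom_p C D)) :
  exists h : PseudoNat L M, precomp_cone colim_cone (M : Hom_p C D) h = m.
Proof.
have lmed0 := lmediating0 pseudocolimit_universal Lnat Lnat2 (transpose_cone m).
have lmed1 := lmediating1 pseudocolimit_universal Lnat Lnat2 (transpose_cone m).
set h := lmediating _ _ _ _ in lmed0 lmed1.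
have e0 i c : h c ∘ l c i = (m i : PseudoNat _ _) c.
  exact: (f_equal (fun s : PseudoNat _ _ => s i) (lmed0 c)).
have e i : comp_pseudonat h (colim0 i) = m i.
  apply: PseudoNat_cell_ext => [c|c c' f]; first exact: e0.
  rewrite colim_whisker; exact: (cell_md i (lmed1 c c' f)).
exists h; apply: PseudoNat_cell_ext => // i j u.
apply: Modification_cell_ext => [||c].
- exact: (f_equal (comp_pseudonat (id_pseudonat M)) (e i)).
- exact: (f_equal (fun s => comp_pseudonat s (nat u)) (e j)).
- rewrite colim_post -(ev_cone_cell m).
  have := f_equal (fun s : PseudoNat _ _ => ⌈pn1 s u⌉) (lmed0 c).
  by rewrite const_comp_cell.
Qed.

Lemma colim_inj (h h' : PseudoNat L M) :
  precomp_cone colim_cone (M : Hom_p C D) h = precomp_cone colim_cone (M : Hom_p C D) h' ->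
  h = h'.
Proof.
move=> e.
have e' i : comp_pseudonat h (colim0 i) = comp_pseudonat h' (colim0 i).
  by rewrite -!precomp_colim0 e.
have e0 c : tf1 (diagonal I D) (h c) ∘ lE c = tf1 (diagonal I D) (h' c) ∘ lE c.
  apply: PseudoNat_cell_ext => [i|i j u].
    exact: (f_equal (fun s : PseudoNat _ _ => s c) (e' i)).
  rewrite !const_comp_cell -!colim_post.
  exact: (f_equal (fun s : PseudoCone F (M : Hom_p C D) => ⌈md (pn1 s u) c⌉) e).
apply: (lmediating_unique pseudocolimit_universal) => // c c' f.
rewrite -!cell_rw; apply: Modification_cell_ext => [||i].
- by rewrite !tf_comp1 -!comp1A e0.
- by rewrite !tf_comp1 -!comp1A Lnat !comp1A e0.
- rewrite !colim_lE -!colim_whisker; exact: (f_equal (fun s : PseudoNat _ _ => ⌈pn1 s f⌉) (e' i)).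
Qed.

Lemma colim_full (h h' : PseudoNat L M)
    (r : Modification (precomp_cone colim_cone (M : Hom_p C D) h)
                      (precomp_cone colim_cone (M : Hom_p C D) h')) :
  exists a : Modification h h', fmor (precomp_cone colim_cone (M : Hom_p C D)) a = r.
Proof.
have rE c i j (u : hom i j) : lw (h' c) ⌈pn1 (l c) u⌉ ⊙ ⌈md (md r i) c⌉
    = rw (nat u c) ⌈md (md r j) c⌉ ⊙ lw (h c) ⌈pn1 (l c) u⌉.
  rewrite -!colim_post -[⌈md (md r i) c⌉]lw_id -cell_lw -cell_rw.
  rewrite -!cell_comp; exact: (f_equal (fun t : Modification _ _ => ⌈md t c⌉) (md_nat r u)).
have rc_nat c i j (u : hom i j) :
    pn1 (tf1 (diagonal I D) (h' c) ∘ lE c : PseudoNat _ _) u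
      • (pf1 (const_2functor I (M c)) u ◁ md (md r i) c)
    = (md (md r j) c ▷ pf1 (comp_2functor (ev_p D c) F) u)
      • pn1 (tf1 (diagonal I D) (h c) ∘ lE c : PseudoNat _ _) u.
  apply: cell_inj; rewrite [LHS]cell_comp [RHS]cell_comp.
  rewrite (const_comp_cell (h' c)) (const_comp_cell (h c)) cell_lw lw_id; exact: rE.
(* The family [r] of modifications in [c] indexed by [i] is regrouped into modifications in [i]
   indexed by [c]. The cone law of [r] makes each [rc c] a modification; the law of each [md r i] is
   what [lmediating_full] asks for. *)
pose rc c := @Build_Modification _ _ _ _ (tf1 (diagonal I D) (h c) ∘ lE c)
  (tf1 (diagonal I D) (h' c) ∘ lE c) (fun i => md (md r i) c) (rc_nat c).
have [|a aK] := lmediating_full pseudocolimit_universal Lnat (r := rc).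
  move=> c c' f.
  (* The boundaries in the middle of the two composites match only after associativity ([p]) and
     2-naturality of [l] ([q]). Inserting the corresponding [eqm]s makes both sides cells of genuine
     modifications, comparable at each [i]. *)
  have p (k : PseudoNat L M) : tf1 (diagonal I D) (tf1 M f) ∘ (tf1 (diagonal I D) (k c) ∘ lE c)
      = tf1 (diagonal I D) (tf1 M f ∘ k c) ∘ lE c by rewrite tf_comp1 comp1A.
  have q (k : PseudoNat L M) : tf1 (diagonal I D) (k c' ∘ tf1 L1 f) ∘ lE c
      = tf1 (diagonal I D) (k c') ∘ lE c' ∘ tf1 (transpose F) f.
    by rewrite tf_comp1 -comp1A Lnat comp1A.
  rewrite -!cell_rw -!cell_lw -(cell_eqml (p h')) -(cell_eqml (q h)) -!cell_comp.
  apply: Modification_cell_ext => [||i]; [exact: p | exact: q | ].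
  rewrite !cell_md_comp.
  have := md_nat_cell (md r i : Modification _ _) f; rewrite !colim_whisker; exact id.
exists a; apply: Modification_ext => i; apply: Modification_ext => c.
exact: (f_equal (fun t : Modification _ _ => md t i) (aK c)).
Qed.

Lemma colim_faith (h h' : PseudoNat L M) (a b : Modification h h') :
  fmor (precomp_cone colim_cone (M : Hom_p C D)) a
  = fmor (precomp_cone colim_cone (M : Hom_p C D)) b -> a = b.
Proof.
move=> e.
have e' c i : a c ▷ l c i = b c ▷ l c i.
  have := f_equal (fun t : Modification (precomp_cone colim_cone (M : Hom_p C D) h)
                      (precomp_cone colim_cone (M : Hom_p C D) h') => md (md t i) c) e.
  exact id.
apply: Modification_ext => c; apply: (luniv_faith pseudocolimit_universal).
apply: Modification_ext => i; exact: e'.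
Qed.

Lemma colim_reflects_2natural (h : PseudoNat L M) :
  (forall i, is_2natural (comp_pseudonat h (colim0 i))) -> is_2natural h.
Proof.
move=> H c c' f.
(* The whiskered 2-cell is an identity at each [i], hence an identity in [PseudoFun I D]. The
   equality [e] of its boundaries is then reflected by [luniv_inj], before the 2-cell itself can be
   compared with an [eqm]. *)
have [|e re] := modification_eqm (r := fmor (tf1 (diagonal I D)) (pn1 h f) ▷ lE c).
  move=> i; have [e he] := H i c c' f.
  have E := colim_whisker h i f; rewrite he cell_eqm in E.
  exists (etrans (esym (cell_dom E)) (cell_cod E)).
  by apply: cell_inj; rewrite colim_lE -E cell_eqm (cell_dom E).
have e' : tf1 M f ∘ h c = h c' ∘ tf1 L f by exact: (luniv_inj pseudocolimit_universal e).
exists e'; apply: cell_inj; apply: (luniv_faith_cell pseudocolimit_universal).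
by rewrite -!cell_rw re; cells.
Qed.
End Vertex.

Lemma colim_cone_colimit : is_pseudocolimit colim_cone.
Proof.
move=> M; apply/cat_isomorphismP; split.
- exact: colim_sur.
- exact: colim_inj.
- exact: colim_full.
- exact: colim_faith.
Qed.

Lemma colim_cone_2natural (i : I) : is_2natural (colim_cone i).
Proof. by move=> c c' f; eexists. Qed.

Lemma colim_cone_image (c : C) : image_cone (ev_p D c) colim_cone = l c.
Proof. by apply: PseudoNat_cell_ext => // i j u; rewrite ev_cone_cell. Qed.
End Colimits.

(** The last clause is recorded for [Hom]: there a mediating transformation out of [L] must be shown
    to be 2-natural, and only its composites with the cone are known. *)
Theorem homp_pseudocolimit (C D I : TwoCat) (F : PseudoFunctor I (Hom_p C D)) (L0 : C -> D)
    (l : forall c : C, PseudoCone (comp_2functor (ev_p D c) F) (L0 c)) :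
  (forall c, is_pseudocolimit (l c)) ->
  exists (L1 : TwoFunctorOn L0) (lam : PseudoCone F (Build_TwoFunctor L1 : Hom_p C D)),
    [/\ forall i, is_2natural (lam i),
        forall c, image_cone (ev_p D c) lam = l c,
        is_pseudocolimit lam
      & forall (M : TwoFunctor C D) (h : PseudoNat (Build_TwoFunctor L1) M),
          (forall i, is_2natural (comp_pseudonat h (lam i))) -> is_2natural h].
Proof.
move=> Hl; have [L1 [Lnat Lnat2]] := left_functor_exists (pseudocolimit_universal Hl).
exists L1, (colim_cone Lnat Lnat2); split.
- exact: colim_cone_2natural.
- exact: colim_cone_image.
- exact: colim_cone_colimit.
- exact: colim_reflects_2natural.
Qed.

(** * Pseudo-limits in [Hom_p] *)

Lemma comp_id_cell (C D : TwoCat) (F G : PseudoFunctor C D) (s : PseudoNat F G)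
    (x y : C) (f : hom x y) :
  ⌈pn1 (comp_pseudonat s (id_pseudonat F)) f⌉ = ⌈pn1 s f⌉.
Proof. by rewrite comp_pseudonat1r. Qed.

Lemma image_dual_cone_cell (I B B' : TwoCat) (G : TwoFunctor B B') (F : PseudoFunctor I B)
    (X : B) (l : DualPseudoCone F X) (i j : I) (u : hom i j) :
  ⌈pn1 (image_dual_cone G l) u⌉ = ⌈fmor (tf1 G) (pn1 l u)⌉.
Proof. by rewrite /=; cells. Qed.

Lemma comp_const_cell (I D : TwoCat) (G : PseudoFunctor I D) (X Y : D) (h : hom Y X)
    (l : DualPseudoCone G X) (i j : I) (u : hom i j) :
  ⌈pn1 (comp_pseudonat l (const_pseudonat I h)) u⌉ = rw h ⌈pn1 l u⌉.
Proof.
rewrite comp_pseudonat_cell /= cell_eqml cell_eqm lw_idm -cell_rw vcomp_unitl //.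
by rewrite -comp1A comp1l.
Qed.

Section DualConeLaws.
Context {I B : TwoCat} (G : PseudoFunctor I B) {X : B} (l : DualPseudoCone G X).

(** In a dual cone the cells of [G] act on the source of [pn1 l u], so the laws carry them on the
    right, next to the cone 2-cell. *)
Lemma dual_cone_nat (i j : I) (u u' : hom i j) (a : mor u u') :
  ⌈pn1 l u'⌉ ⊙ rw (l i) ⌈fmor (pf1 G) a⌉ = ⌈pn1 l u⌉.
Proof. by have := f_equal (@cell _ _ _) (pn_nat l a); rewrite /=; cells. Qed.

Lemma dual_cone_id (i : I) :
  ⌈pn1 l (id1 i)⌉ ⊙ rw (l i) ⌈pf_id G i⌉ = ⌈idm (l i)⌉.
Proof.
have := f_equal (@cell _ _ _) (pn_id l i); rewrite /=; cells => ->.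
by rewrite comp1l.
Qed.

Lemma dual_cone_comp (i j k : I) (v : hom j k) (u : hom i j) :
  ⌈pn1 l (v ∘ u)⌉ ⊙ rw (l i) ⌈pf_comp G v u⌉ = ⌈pn1 l v⌉ ⊙ lw (pf1 G v) ⌈pn1 l u⌉.
Proof. by have := f_equal (@cell _ _ _) (pn_comp l v u); rewrite /=; cells. Qed.
End DualConeLaws.

(** * Dual pseudo-cones in [Hom_p] and their transposes *)

Section HomDualCones.
Context {C D I : TwoCat} (F : PseudoFunctor I (Hom_p C D)).
Local Notation nat u := (pf1 F u : PseudoNat (pf0 F _) (pf0 F _)).
Local Notation md2 a := (fmor (pf1 F) a : Modification _ _).
Local Notation mdid i := (pf_id F i : Modification _ _).
Local Notation mdcomp v u := (pf_comp F v u : Modification _ _).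

Section DualCone.
Context {M : TwoFunctor C D} (m0 : forall i, PseudoNat M (F i))
  (m1 : forall i j (u : hom i j) (c : C), mor (nat u c ∘ m0 i c) (m0 j c ∘ id1 (M c))).
Arguments m1 {i j} u c.
Context
  (m1_iso : forall i j (u : hom i j) (c : C), is_iso (m1 u c))
  (m1_mod : forall i j (u : hom i j) (c c' : C) (f : hom c c'),
    ⌈pn1 (m0 j) f⌉ ⊙ lw (tf1 (F j) f) ⌈m1 u c⌉
    = rw (tf1 M f) ⌈m1 u c'⌉ ⊙ lw (nat u c') ⌈pn1 (m0 i) f⌉ ⊙ rw (m0 i c) ⌈pn1 (nat u) f⌉)
  (m1_nat : forall i j (u u' : hom i j) (a : mor u u') (c : C),
    ⌈m1 u' c⌉ ⊙ rw (m0 i c) ⌈md2 a c⌉ = ⌈m1 u c⌉)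
  (m1_id : forall i c, ⌈m1 (id1 i) c⌉ ⊙ rw (m0 i c) ⌈mdid i c⌉ = ⌈idm (m0 i c)⌉)
  (m1_comp : forall i j k (v : hom j k) (u : hom i j) (c : C),
    ⌈m1 (v ∘ u) c⌉ ⊙ rw (m0 i c) ⌈mdcomp v u c⌉ = ⌈m1 v c⌉ ⊙ lw (nat v c) ⌈m1 u c⌉).

Program Definition homp_dual_cone_mod (i j : I) (u : hom i j) :
    Modification (comp_pseudonat (nat u) (m0 i)) (comp_pseudonat (m0 j) (id_pseudonat M)) :=
  {| md := m1 u |}.
Next Obligation.
apply: cell_inj; rewrite [LHS]cell_comp [RHS]cell_comp comp_id_cell comp_pseudonat_cell.
rewrite cell_lw cell_rw; exact: m1_mod.
Qed.

Program Definition homp_dual_cone : DualPseudoCone F (M : Hom_p C D) :=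
  {| pn0 := m0; pn1 := homp_dual_cone_mod |}.
Next Obligation. apply: is_iso_modification => c; exact: m1_iso. Qed.
Next Obligation.
apply: Modification_ext => c; apply: cell_inj; rewrite /=; cells; exact: m1_nat.
Qed.
Next Obligation.
apply: Modification_ext => c; apply: cell_inj; rewrite /= !eqm_md /=; cells.
by rewrite comp1l; exact: m1_id.
Qed.
Next Obligation.
apply: Modification_ext => c; apply: cell_inj; rewrite /= !eqm_md /=; cells; exact: m1_comp.
Qed.
End DualCone.

Section StrictDualCone.
Context {M : TwoFunctor C D} (s0 : forall (c : C) (i : I), hom (M c) (F i c)).
Arguments s0 : clear implicits.
Context (e : forall i c c' (f : hom c c'), tf1 (F i) f ∘ s0 c i = s0 c' i ∘ tf1 M f)
  (n : forall i c c' (f f' : hom c c') (a : mor f f'),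
    rw (s0 c i) ⌈fmor (tf1 (F i)) a⌉ = lw (s0 c' i) ⌈fmor (tf1 M) a⌉)
  (m1 : forall c i j (u : hom i j), mor (nat u c ∘ s0 c i) (s0 c j ∘ id1 (M c))).
Arguments m1 c {i j} u.

(** Here [istr F u f] is whiskered on the right with [s0 c i] and stands at the source end, so it
    cancels against the last factor of the modification law. *)
Lemma strict_homp_dual_cone_mod :
  (forall i j (u : hom i j) c c' (f : hom c c'),
    rw (tf1 M f) ⌈m1 c' u⌉ = lw (tf1 (F j) f) ⌈m1 c u⌉ ⊙ rw (s0 c i) ⌈istr F u f⌉) ->
  forall i j (u : hom i j) c c' (f : hom c c'),
    ⌈pn1 (strict_pseudonat (e j) (n j)) f⌉ ⊙ lw (tf1 (F j) f) ⌈m1 c u⌉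
    = rw (tf1 M f) ⌈m1 c' u⌉ ⊙ lw (nat u c') ⌈pn1 (strict_pseudonat (e i) (n i)) f⌉
      ⊙ rw (s0 c i) ⌈pn1 (nat u) f⌉.
Proof.
move=> H i j u c c' f.
rewrite /= !cell_eqm lw_idm -[lw _ ⌈m1 c u⌉]cell_lw vcomp_unitl ?comp1r // cell_lw.
rewrite -[rw _ ⌈pn1 (nat u) f⌉]cell_rw vcomp_unitl ?comp1A // cell_rw.
by rewrite H vcompA rw_invl -cell_lw vcomp_unitr ?comp1A.
Qed.
End StrictDualCone.

Section DualComponents.
Context {M : TwoFunctor C D} (m : DualPseudoCone F (M : Hom_p C D)).
Local Notation m0 := (fun i => m i : PseudoNat M (F i)).
Local Notation m1 u := (pn1 m u : Modification _ _).

Lemma homp_dual_cone_modE (i j : I) (u : hom i j) (c c' : C) (f : hom c c') :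
  ⌈pn1 (m0 j) f⌉ ⊙ lw (tf1 (F j) f) ⌈m1 u c⌉
  = rw (tf1 M f) ⌈m1 u c'⌉ ⊙ lw (nat u c') ⌈pn1 (m0 i) f⌉ ⊙ rw (m0 i c) ⌈pn1 (nat u) f⌉.
Proof.
have := md_nat_cell (m1 u) f.
by rewrite comp_id_cell comp_pseudonat_cell.
Qed.

Lemma ev_dual_cone_cell (i j : I) (u : hom i j) (c : C) :
  ⌈pn1 (image_dual_cone (ev_p D c) m) u⌉ = ⌈m1 u c⌉.
Proof. exact: image_dual_cone_cell. Qed.

Lemma transpose_dual_cone_mod (i j : I) (u : hom i j) (c c' : C) (f : hom c c') :
  rw (tf1 M f) ⌈m1 u c'⌉ ⊙ lw (nat u c') ⌈pn1 (m0 i) f⌉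
  = ⌈pn1 (m0 j) f⌉ ⊙ lw (tf1 (F j) f) ⌈m1 u c⌉ ⊙ rw (m0 i c) ⌈istr F u f⌉.
Proof.
rewrite -[RHS]vcompA homp_dual_cone_modE !vcompA rw_invr.
by rewrite -[lw (nat u c') _]cell_lw vcomp_unitr // comp1A.
Qed.

Program Definition transpose_dual_cone1 (c c' : C) (f : hom c c') :
    Modification
      (comp_pseudonat (transpose1 F f) (image_dual_cone (ev_p D c) m))
      (comp_pseudonat (image_dual_cone (ev_p D c') m) (const_pseudonat I (tf1 M f))) :=
  {| md := fun i => pn1 (m0 i) f |}.
Next Obligation.
apply: cell_inj; rewrite [LHS]cell_comp [RHS]cell_comp comp_const_cell comp_pseudonat_cell.
rewrite !ev_dual_cone_cell /= cell_lw cell_rw rw_id; exact: transpose_dual_cone_mod.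
Qed.

Program Definition transpose_dual_cone :
    PseudoNat (comp_2functor (diagonal I D) M) (transpose F) :=
  {| pn0 := fun c => image_dual_cone (ev_p D c) m; pn1 := transpose_dual_cone1 |}.
Next Obligation. apply: is_iso_modification => i; exact: (pn1_iso (m0 i)). Qed.
Next Obligation.
apply: Modification_ext => i; apply: cell_inj.
have := f_equal (@cell _ _ _) (pn_nat (m0 i) a).
by [].
Qed.
Next Obligation.
apply: Modification_ext => i; apply: cell_inj.
have := f_equal (@cell _ _ _) (pn_id (m0 i) x).
by rewrite /= !eqm_md /=; cells.
Qed.
Next Obligation.
apply: Modification_ext => i; apply: cell_inj.
have := f_equal (@cell _ _ _) (pn_comp (m0 i) g f).
by rewrite /= !eqm_md /=; cells.
Qed.
End DualComponents.
End HomDualCones.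

(** * The pointwise pseudo-limit and its universal property *)

Section Limits.
Context {C D I : TwoCat} (F : PseudoFunctor I (Hom_p C D)) (L0 : C -> D)
  (l : forall c : C, DualPseudoCone (comp_2functor (ev_p D c) F) (L0 c)).
Local Notation nat u := (pf1 F u : PseudoNat (pf0 F _) (pf0 F _)).
Local Notation lE c := (l c : hom (diagonal I D (L0 c)) (transpose F c)).
Hypothesis Hl : forall c, is_pseudolimit (l c).

Lemma pseudolimit_universal :
  right_universal (Delta := diagonal I D) (G := transpose F) l.
Proof. by split=> c X; have /cat_isomorphismP [] := Hl c X. Qed.

Context (L1 : TwoFunctorOn L0)
  (Lnat : forall c c' (f : hom c c'),
    lE c' ∘ tf1 (diagonal I D) (tf1 L1 f) = tf1 (transpose F) f ∘ lE c)
  (Lnat2 : forall c c' (f f' : hom c c') (a : mor f f'),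
    lw (lE c') ⌈fmor (tf1 (diagonal I D)) (fmor (tf1 L1) a)⌉
    = rw (lE c) ⌈fmor (tf1 (transpose F)) a⌉).
Let L : TwoFunctor C D := Build_TwoFunctor L1.

Lemma lim_nat0 (i : I) (c c' : C) (f : hom c c') :
  tf1 (F i) f ∘ l c i = l c' i ∘ tf1 L f.
Proof. exact: (f_equal (fun s : PseudoNat _ _ => s i) (esym (Lnat f))). Qed.

Lemma lim_nat1 (i j : I) (u : hom i j) (c c' : C) (f : hom c c') :
  rw (tf1 L f) ⌈pn1 (l c') u⌉ = lw (tf1 (F j) f) ⌈pn1 (l c) u⌉ ⊙ rw (l c i) ⌈istr F u f⌉.
Proof.
have := f_equal (fun s : PseudoNat _ _ => ⌈pn1 s u⌉) (Lnat f).
by rewrite comp_const_cell comp_pseudonat_cell.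
Qed.

Lemma lim_nat2 (i : I) (c c' : C) (f f' : hom c c') (a : mor f f') :
  rw (l c i) ⌈fmor (tf1 (F i)) a⌉ = lw (l c' i) ⌈fmor (tf1 L) a⌉.
Proof. have := esym (Lnat2 a); rewrite -cell_lw -cell_rw; exact: (cell_md i). Qed.

Definition lim0 (i : I) : PseudoNat L (F i) :=
  strict_pseudonat (F := L) (G := F i) (s := fun c => l c i) (lim_nat0 i) (lim_nat2 i).

Program Definition lim_cone : DualPseudoCone F (L : Hom_p C D) :=
  homp_dual_cone (m0 := lim0) (m1 := fun i j u c => pn1 (l c) u) _ _ _ _ _.
Next Obligation. exact: (pn1_iso (l c)). Qed.
Next Obligation.
exact (strict_homp_dual_cone_mod (F := F) (M := L) (s0 := fun c i => l c i)
  lim_nat0 lim_nat2 (m1 := fun c i j u => pn1 (l c) u) (fun i j u c c' f => lim_nat1 u f) u f).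
Qed.
Next Obligation. exact: (dual_cone_nat (l c)). Qed.
Next Obligation.
by apply: etrans (dual_cone_id (l c) i); rewrite comp_2functor_id_cell.
Qed.
Next Obligation.
by apply: etrans (dual_cone_comp (l c) v u); rewrite comp_2functor_comp_cell.
Qed.

Section Vertex.
Context (M : TwoFunctor C D).

Lemma lim_whisker (h : PseudoNat M L) (i : I) (c c' : C) (f : hom c c') :
  ⌈pn1 (comp_pseudonat (lim0 i) h) f⌉ = lw (l c' i) ⌈pn1 h f⌉.
Proof.
rewrite comp_pseudonat_cell /= cell_eqm rw_idm -cell_lw vcomp_unitr //.
by rewrite lim_nat0 comp1A.
Qed.

Lemma lim_post (h : PseudoNat M L) (i j : I) (u : hom i j) (c : C) :
  ⌈md (pn1 (postcomp_cone lim_cone (M : Hom_p C D) h) u) c⌉ = rw (h c) ⌈pn1 (l c) u⌉.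
Proof.
have e := comp_const_cell (h : hom (M : Hom_p C D) L) lim_cone u.
exact: (cell_md c e).
Qed.

Lemma postcomp_lim0 (h : PseudoNat M L) (i : I) :
  pn0 (postcomp_cone lim_cone (M : Hom_p C D) h) i = comp_pseudonat (lim0 i) h.
Proof. by []. Qed.

Lemma lim_lE (c : C) (X : D) (h h' : hom X (L0 c)) (a : mor h h') (i : I) :
  ⌈md (lE c ◁ fmor (tf1 (diagonal I D)) a) i⌉ = lw (l c i) ⌈a⌉.
Proof. by []. Qed.

Lemma lim_sur (m : DualPseudoCone F (M : Hom_p C D)) :
  exists h : PseudoNat M L, postcomp_cone lim_cone (M : Hom_p C D) h = m.
Proof.
have rmed0 := rmediating0 pseudolimit_universal Lnat Lnat2 (transpose_dual_cone m).
have rmed1 := rmediating1 pseudolimit_universal Lnat Lnat2 (transpose_dual_cone m).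
set h := rmediating _ _ _ _ in rmed0 rmed1.
have e0 i c : l c i ∘ h c = (m i : PseudoNat _ _) c.
  exact: (f_equal (fun s : PseudoNat _ _ => s i) (rmed0 c)).
have e i : comp_pseudonat (lim0 i) h = m i.
  apply: PseudoNat_cell_ext => [c|c c' f]; first exact: e0.
  rewrite lim_whisker; exact: (cell_md i (rmed1 c c' f)).
exists h; apply: PseudoNat_cell_ext => // i j u.
apply: Modification_cell_ext => [||c].
- exact: (f_equal (comp_pseudonat (nat u)) (e i)).
- exact: (f_equal (fun s => comp_pseudonat s (id_pseudonat M)) (e j)).
- rewrite lim_post -(ev_dual_cone_cell m).
  have := f_equal (fun s : PseudoNat _ _ => ⌈pn1 s u⌉) (rmed0 c).
  by rewrite comp_const_cell.
Qed.

Lemma lim_inj (h h' : PseudoNat M L) :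
  postcomp_cone lim_cone (M : Hom_p C D) h = postcomp_cone lim_cone (M : Hom_p C D) h' ->
  h = h'.
Proof.
move=> e.
have e' i : comp_pseudonat (lim0 i) h = comp_pseudonat (lim0 i) h'.
  by rewrite -!postcomp_lim0 e.
have e0 c : lE c ∘ tf1 (diagonal I D) (h c) = lE c ∘ tf1 (diagonal I D) (h' c).
  apply: PseudoNat_cell_ext => [i|i j u].
    exact: (f_equal (fun s : PseudoNat _ _ => s c) (e' i)).
  rewrite !comp_const_cell -!lim_post.
  exact: (f_equal (fun s : DualPseudoCone F (M : Hom_p C D) => ⌈md (pn1 s u) c⌉) e).
apply: (rmediating_unique pseudolimit_universal) => // c c' f.
rewrite -!cell_lw; apply: Modification_cell_ext => [||i].
- by rewrite !tf_comp1 !comp1A Lnat -!comp1A e0.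
- by rewrite !tf_comp1 !comp1A e0.
- rewrite !lim_lE -!lim_whisker; exact: (f_equal (fun s : PseudoNat _ _ => ⌈pn1 s f⌉) (e' i)).
Qed.

Lemma lim_full (h h' : PseudoNat M L)
    (r : Modification (postcomp_cone lim_cone (M : Hom_p C D) h)
                      (postcomp_cone lim_cone (M : Hom_p C D) h')) :
  exists a : Modification h h', fmor (postcomp_cone lim_cone (M : Hom_p C D)) a = r.
Proof.
have rE c i j (u : hom i j) : rw (h' c) ⌈pn1 (l c) u⌉ ⊙ lw (nat u c) ⌈md (md r i) c⌉
    = ⌈md (md r j) c⌉ ⊙ rw (h c) ⌈pn1 (l c) u⌉.
  rewrite -!lim_post -[⌈md (md r j) c⌉]rw_id -cell_lw -cell_rw.
  rewrite -!cell_comp; exact: (f_equal (fun t : Modification _ _ => ⌈md t c⌉) (md_nat r u)).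
have rc_nat c i j (u : hom i j) :
    pn1 (lE c ∘ tf1 (diagonal I D) (h' c) : PseudoNat _ _) u
      • (pf1 (comp_2functor (ev_p D c) F) u ◁ md (md r i) c)
    = (md (md r j) c ▷ pf1 (const_2functor I (M c)) u)
      • pn1 (lE c ∘ tf1 (diagonal I D) (h c) : PseudoNat _ _) u.
  apply: cell_inj; rewrite [LHS]cell_comp [RHS]cell_comp.
  rewrite (comp_const_cell (h' c)) (comp_const_cell (h c)) cell_rw rw_id; exact: rE.
pose rc c := @Build_Modification _ _ _ _ (lE c ∘ tf1 (diagonal I D) (h c))
  (lE c ∘ tf1 (diagonal I D) (h' c)) (fun i => md (md r i) c) (rc_nat c).
have [|a aK] := rmediating_full pseudolimit_universal Lnat (r := rc).
  move=> c c' f.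
  (* The roles differ from the colimit case: 2-naturality of [l] now enters through [p], and [q] is
     functoriality of the diagonal with associativity. *)
  have p (k : PseudoNat M L) : tf1 (transpose F) f ∘ (lE c ∘ tf1 (diagonal I D) (k c))
      = lE c' ∘ tf1 (diagonal I D) (tf1 L1 f ∘ k c).
    by rewrite tf_comp1 comp1A -Lnat comp1A.
  have q (k : PseudoNat M L) : lE c' ∘ tf1 (diagonal I D) (k c' ∘ tf1 M f)
      = lE c' ∘ tf1 (diagonal I D) (k c') ∘ tf1 (diagonal I D) (tf1 M f).
    by rewrite tf_comp1 comp1A.
  rewrite -!cell_rw -!cell_lw -(cell_eqml (p h')) -(cell_eqml (q h)) -!cell_comp.
  apply: Modification_cell_ext => [||i]; [exact: p | exact: q | ].
  rewrite !cell_md_comp.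
  have := md_nat_cell (md r i : Modification _ _) f; rewrite !lim_whisker; exact id.
exists a; apply: Modification_ext => i; apply: Modification_ext => c.
exact: (f_equal (fun t : Modification _ _ => md t i) (aK c)).
Qed.

Lemma lim_faith (h h' : PseudoNat M L) (a b : Modification h h') :
  fmor (postcomp_cone lim_cone (M : Hom_p C D)) a
  = fmor (postcomp_cone lim_cone (M : Hom_p C D)) b -> a = b.
Proof.
move=> e.
have e' c i : l c i ◁ a c = l c i ◁ b c.
  have := f_equal (fun t : Modification (postcomp_cone lim_cone (M : Hom_p C D) h)
                      (postcomp_cone lim_cone (M : Hom_p C D) h') => md (md t i) c) e.
  exact id.
apply: Modification_ext => c; apply: (runiv_faith pseudolimit_universal).
apply: Modification_ext => i; exact: e'.
Qed.

Lemma lim_reflects_2natural (h : PseudoNat M L) :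
  (forall i, is_2natural (comp_pseudonat (lim0 i) h)) -> is_2natural h.
Proof.
move=> H c c' f.
have [|e re] := modification_eqm (r := lE c' ◁ fmor (tf1 (diagonal I D)) (pn1 h f)).
  move=> i; have [e he] := H i c c' f.
  have E := lim_whisker h i f; rewrite he cell_eqm in E.
  exists (etrans (esym (cell_dom E)) (cell_cod E)).
  by apply: cell_inj; rewrite lim_lE -E cell_eqm (cell_dom E).
have e' : tf1 L f ∘ h c = h c' ∘ tf1 M f by exact: (runiv_inj pseudolimit_universal e).
exists e'; apply: cell_inj; apply: (runiv_faith_cell pseudolimit_universal).
by rewrite -!cell_lw re; cells.
Qed.
End Vertex.

Lemma lim_cone_limit : is_pseudolimit lim_cone.
Proof.
move=> M; apply/cat_isomorphismP; split.
- exact: lim_sur.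
- exact: lim_inj.
- exact: lim_full.
- exact: lim_faith.
Qed.

Lemma lim_cone_2natural (i : I) : is_2natural (lim_cone i).
Proof. by move=> c c' f; eexists. Qed.

Lemma lim_cone_image (c : C) : image_dual_cone (ev_p D c) lim_cone = l c.
Proof. by apply: PseudoNat_cell_ext => // i j u; rewrite ev_dual_cone_cell. Qed.
End Limits.

(** The last clause again serves [Hom], now for transformations into [L] tested against the
    projections. *)
Theorem homp_pseudolimit (C D I : TwoCat) (F : PseudoFunctor I (Hom_p C D)) (L0 : C -> D)
    (l : forall c : C, DualPseudoCone (comp_2functor (ev_p D c) F) (L0 c)) :
  (forall c, is_pseudolimit (l c)) ->
  exists (L1 : TwoFunctorOn L0) (lam : DualPseudoCone F (Build_TwoFunctor L1 : Hom_p C D)),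
    [/\ forall i, is_2natural (lam i),
        forall c, image_dual_cone (ev_p D c) lam = l c,
        is_pseudolimit lam
      & forall (M : TwoFunctor C D) (h : PseudoNat M (Build_TwoFunctor L1)),
          (forall i, is_2natural (comp_pseudonat (lam i) h)) -> is_2natural h].
Proof.
move=> Hl; have [L1 [Lnat Lnat2]] := right_functor_exists (pseudolimit_universal Hl).
exists L1, (lim_cone Lnat Lnat2); split.
- exact: lim_cone_2natural.
- exact: lim_cone_image.
- exact: lim_cone_limit.
- exact: lim_reflects_2natural.
Qed.

(** * Restriction to 2-natural transformations *)

Section ElementaryColimits.
Context {I B : TwoCat} (G : PseudoFunctor I B).

Program Definition mk_cone (X : B) (m0 : forall i, hom (G i) X)
    (m1 : forall i j (u : hom i j), mor (id1 X ∘ m0 i) (m0 j ∘ pf1 G u))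
    (m1_iso : forall i j (u : hom i j), is_iso (m1 i j u))
    (m1_nat : forall i j (u u' : hom i j) (a : mor u u'),
      ⌈m1 i j u'⌉ = lw (m0 j) ⌈fmor (pf1 G) a⌉ ⊙ ⌈m1 i j u⌉)
    (m1_id : forall i, ⌈m1 i i (id1 i)⌉ = lw (m0 i) ⌈pf_id G i⌉)
    (m1_comp : forall i j k (v : hom j k) (u : hom i j),
      ⌈m1 i k (v ∘ u)⌉
      = lw (m0 k) ⌈pf_comp G v u⌉ ⊙ rw (pf1 G u) ⌈m1 j k v⌉ ⊙ ⌈m1 i j u⌉) :
    PseudoCone G X :=
  {| pn0 := m0; pn1 := m1 |}.
Next Obligation. exact: m1_iso. Qed.
Next Obligation. apply: cell_inj; cells; exact: m1_nat. Qed.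
Next Obligation. apply: cell_inj; cells; exact: m1_id. Qed.
Next Obligation. apply: cell_inj; cells; exact: m1_comp. Qed.

(** This is the modification law between the composites of [l] with [h] and [h'], with the identity
    1-cells of the constant 2-functor removed. *)
Definition compatible (X Y : B) (l : PseudoCone G X) (h h' : hom X Y)
    (r : forall i, mor (h ∘ l i) (h' ∘ l i)) : Prop :=
  forall i j (u : hom i j),
    lw h' ⌈pn1 l u⌉ ⊙ ⌈r i⌉ = rw (pf1 G u) ⌈r j⌉ ⊙ lw h ⌈pn1 l u⌉.

Program Definition mk_precomp_modification (X Y : B) (l : PseudoCone G X) (h h' : hom X Y)
    (r : forall i, mor (h ∘ l i) (h' ∘ l i)) (Hr : compatible r) :
    Modification (precomp_cone l Y h) (precomp_cone l Y h') :=
  {| md := r |}.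
Next Obligation.
apply: cell_inj; rewrite [LHS]cell_comp [RHS]cell_comp !const_comp_cell cell_lw lw_id.
exact: Hr.
Qed.

(** Unfolding the category of cones leaves conditions on cells of [B]. These can be compared between
    different diagrams or 2-categories having the same underlying cells, where the categories of
    cones themselves have different types. *)
Lemma pseudocolimitP (X : B) (l : PseudoCone G X) :
  is_pseudocolimit l <-> forall Y : B,
  [/\ forall m : PseudoCone G Y, exists h : hom X Y,
        (forall i, h ∘ l i = m i) /\
        forall i j (u : hom i j), lw h ⌈pn1 l u⌉ = ⌈pn1 m u⌉,
      forall h h' : hom X Y, (forall i, h ∘ l i = h' ∘ l i) ->
        (forall i j (u : hom i j), lw h ⌈pn1 l u⌉ = lw h' ⌈pn1 l u⌉) -> h = h',
      forall (h h' : hom X Y) (r : forall i, mor (h ∘ l i) (h' ∘ l i)),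
        compatible r -> exists a : mor h h', forall i, a ▷ l i = r i
    & forall (h h' : hom X Y) (a b : mor h h'), (forall i, a ▷ l i = b ▷ l i) -> a = b].
Proof.
split=> H Y.
- have /cat_isomorphismP [sur inj full faith] := H Y; split.
  + move=> m; have [h e] := sur m; exists h.
    split=> [i|i j u]; last by rewrite -const_comp_cell -e.
    exact: (f_equal (fun m : PseudoCone G Y => m i) e).
  + move=> h h' e0 e1; apply: inj; apply: PseudoNat_cell_ext => // i j u.
    by rewrite !const_comp_cell.
  + move=> h h' r Hr; have [a e] := full h h' (mk_precomp_modification Hr); exists a => i.
    exact: (f_equal (fun r : Modification _ _ => r i) e).
  + move=> h h' a b e; apply: faith; apply: Modification_ext; exact: e.
- have [ex un full faith] := H Y; apply/cat_isomorphismP; split.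
  + move=> m; have [h [h0 h1]] := ex m; exists h.
    by apply: PseudoNat_cell_ext => // i j u; rewrite const_comp_cell.
  + move=> h h' e; apply: un => [i|i j u]; last first.
      by rewrite -!const_comp_cell; exact: (f_equal (fun m : PseudoCone G Y => ⌈pn1 m u⌉) e).
    exact: (f_equal (fun m : PseudoCone G Y => m i) e).
  + move=> h h' r; have [|a ar] := full h h' (fun i => md r i).
      by move=> i j u; have := md_nat_cell r u; rewrite !const_comp_cell lw_id.
    by exists a; apply: Modification_ext => i /=.
  + move=> h h' a b e; apply: faith => i.
    exact: (f_equal (fun r : Modification _ _ => r i) e).
Qed.
End ElementaryColimits.

(** * Cells of a full subcategory *)

Section SubcategoryCells.
Context {C : Category} (P : C -> Prop).

Definition forget_cell (a : option (Cell (full_subcategory P))) : option (Cell C) :=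
  if a is Some a then cell (C := C) (cmor a) else None.

(** The endpoints differ from ambient ones only by membership proofs, which are irrelevant;
    equations in the subcategory may therefore be checked outside it. *)
Lemma forget_cell_inj (a b : option (Cell (full_subcategory P))) :
  forget_cell a = forget_cell b -> a = b.
Proof.
case: a b => [[x y a]|] [[x' y' b]|] //= e.
have p := full_subcategory_eq (cell_dom e); have q := full_subcategory_eq (cell_cod e).
case: x' / p b e; case: y' / q => b e; congr (cell _); exact: (cell_inj e).
Qed.

Lemma forget_cell_vcomp (b a : option (Cell (full_subcategory P))) :
  forget_cell (b ⊙ a) = forget_cell b ⊙ forget_cell a.
Proof.
case: b a => [[z w b]|] [[x y a]|] //; rewrite /vcomp /=.
case: excluded_middle_informative => [e|ne]; case: excluded_middle_informative => [e'|ne'] //=.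
- by rewrite eqm_sub (eqm_irr _ e').
- by case: ne'; rewrite e.
- by case: ne; apply: full_subcategory_eq.
Qed.
End SubcategoryCells.

(** * Pseudo-colimits in a locally full sub-2-category *)

Section LocallyFull.
Context {B : TwoCat} (P : forall x y : B, hom x y -> Prop) (P_id : forall x, @P x x (id1 x))
  (P_comp : forall x y z (g : hom y z) (f : hom x y), @P y z g -> @P x y f -> @P x z (g ∘ f)).
Let BP := locally_full_sub2category P_id P_comp.

Program Definition inclusion_on : TwoFunctorOn (C := BP) (D := B) id :=
  {| tf1 := fun x y => {| fobj := @proj1_sig _ _; fmor := fun _ _ a => a |} |}.
Next Obligation. by []. Qed.
Next Obligation. by []. Qed.
Next Obligation. by []. Qed.
Next Obligation. by []. Qed.
Next Obligation. by rewrite !eqm1 compm1l compm1r. Qed.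

Definition inclusion : TwoFunctor BP B := Build_TwoFunctor inclusion_on.

Context {I : TwoCat} (F : PseudoFunctor I BP).
Local Notation F' := (comp_2functor inclusion F).

Lemma forget_cell_lw (x y z : BP) (g : hom y z) (a : option (Cell (hom x y))) :
  forget_cell (lw g a) = lw (proj1_sig g) (forget_cell a).
Proof. by case: a. Qed.

Lemma forget_cell_rw (x y z : BP) (f : hom x y) (b : option (Cell (hom y z))) :
  forget_cell (rw f b) = rw (proj1_sig f) (forget_cell b).
Proof. by case: b. Qed.

Section Lift.
Context (X : B) (l : PseudoCone F' X) (Pl : forall i, P (l i)).

Let lift0 (i : I) : hom (F i) (X : BP) := exist _ (l i) (Pl i).
Let lift1 (i j : I) (u : hom i j) : mor (id1 (X : BP) ∘ lift0 i) (lift0 j ∘ pf1 F u) :=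
  pn1 l u.

Program Definition lift_cone : PseudoCone F (X : BP) :=
  @mk_cone _ _ F X lift0 lift1 _ _ _ _.
Next Obligation. exact (pn1_iso l u). Qed.
Next Obligation.
apply: forget_cell_inj; rewrite forget_cell_vcomp forget_cell_lw; exact: (cone_nat l a).
Qed.
Next Obligation.
apply: forget_cell_inj; rewrite forget_cell_lw; apply: etrans (cone_id l i) _.
by rewrite comp_2functor_id_cell.
Qed.
Next Obligation.
apply: forget_cell_inj; rewrite !forget_cell_vcomp forget_cell_lw forget_cell_rw.
by apply: etrans (cone_comp l v u) _; rewrite comp_2functor_comp_cell.
Qed.

(** By local fullness the clauses on 2-cells carry over unchanged. The closure condition enters only
    for existence: the composites of the ambient mediating 1-cell with [l] are the components of the
    given cone, which satisfy [P]. *)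
Lemma lift_cone_pseudocolimit :
  is_pseudocolimit l ->
  (forall Y (h : hom X Y), (forall i, P (h ∘ l i)) -> P h) ->
  is_pseudocolimit lift_cone.
Proof.
move=> /pseudocolimitP Hl HP; apply/pseudocolimitP => Y; have [sur inj full faith] := Hl Y.
split.
- move=> m; have [h [h0 h1]] := sur (image_cone inclusion m).
  have Ph : P h by apply: HP => i; rewrite h0; exact: proj2_sig (m i).
  exists (exist _ h Ph); split=> [i|i j u]; first exact/full_subcategory_eq/h0.
  apply: forget_cell_inj; rewrite forget_cell_lw; apply: etrans (h1 i j u) _.
  exact: image_cone_cell.
- move=> h h' e0 e1; apply: full_subcategory_eq; apply: inj => [i|i j u].
  + exact: (f_equal (@proj1_sig _ _) (e0 i)).
  + have := f_equal (@forget_cell _ _) (e1 i j u); by rewrite !forget_cell_lw.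
- move=> h h' r Hr; have [|a ar] := full (proj1_sig h) (proj1_sig h') r; last by exists a.
  move=> i j u; have := f_equal (@forget_cell _ _) (Hr i j u).
  by rewrite !forget_cell_vcomp !forget_cell_lw forget_cell_rw.
- by move=> h h' a b; exact: faith.
Qed.
End Lift.
End LocallyFull.

(** * Pseudo-colimits in [Hom] *)

Section HomCase.
Context {C D I : TwoCat} (F : PseudoFunctor I (Hom C D)).

Definition hom_inclusion : TwoFunctor (Hom C D) (Hom_p C D) :=
  inclusion (B := Hom_p C D) (P := fun F G => @is_2natural C D F G)
    (fun F => is_2natural_id F) (fun F G H t s => @is_2natural_comp C D F G H t s).

Local Notation F' := (comp_2functor hom_inclusion F).
Local Notation G c := (comp_2functor (ev D c) F).
Local Notation G' c := (comp_2functor (ev_p D c) F').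

Lemma ev_fmor (F0 F1 : Hom C D) (c : C) (s t : hom F0 F1) (r : mor s t) :
  ⌈fmor (tf1 (ev D c)) r⌉ = ⌈md (r : Modification _ _) c⌉.
Proof. by []. Qed.

Lemma ev_p_fmor (F0 F1 : Hom_p C D) (c : C) (s t : hom F0 F1) (r : mor s t) :
  ⌈fmor (tf1 (ev_p D c)) r⌉ = ⌈md (r : Modification _ _) c⌉.
Proof. by []. Qed.

Lemma inclusion_fmor (F0 F1 : Hom C D) (c : C) (s t : hom F0 F1) (r : mor s t) :
  ⌈md (fmor (tf1 hom_inclusion) r : Modification _ _) c⌉ = ⌈md (r : Modification _ _) c⌉.
Proof. by []. Qed.

(** Evaluation in [Hom] and evaluation through [Hom_p] have the same objects and 1-cells, but their
    comparison cells carry different [eqm] factors. As cells these agree, which suffices to rebuild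
    a cone over one diagram as a cone over the other. *)
Lemma ev_inclusion_id (c : C) (i : I) : ⌈pf_id (G' c) i⌉ = ⌈pf_id (G c) i⌉.
Proof.
rewrite [LHS]comp_2functor_id_cell [RHS]comp_2functor_id_cell.
refine (etrans (ev_p_fmor _ _) _).
refine (etrans (cell_md c (comp_2functor_id_cell hom_inclusion F i)) _).
exact (etrans (inclusion_fmor _ _) (esym (ev_fmor _ _))).
Qed.

Lemma ev_inclusion_comp (c : C) (i j k : I) (v : hom j k) (u : hom i j) :
  ⌈pf_comp (G' c) v u⌉ = ⌈pf_comp (G c) v u⌉.
Proof.
rewrite [LHS]comp_2functor_comp_cell [RHS]comp_2functor_comp_cell.
refine (etrans (ev_p_fmor _ _) _).
refine (etrans (cell_md c (comp_2functor_comp_cell hom_inclusion F v u)) _).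
exact (etrans (inclusion_fmor _ _) (esym (ev_fmor _ _))).
Qed.

Section Cones.
Context (c : C).

Program Definition ev_cone (X : D) (m : PseudoCone (G c) X) : PseudoCone (G' c) X :=
  @mk_cone _ _ (G' c) X (fun i => m i) (fun i j u => pn1 m u) _ _ _ _.
Next Obligation. exact: (pn1_iso m). Qed.
Next Obligation. exact: (cone_nat m a). Qed.
Next Obligation. by rewrite ev_inclusion_id; exact: (cone_id m i). Qed.
Next Obligation. by rewrite ev_inclusion_comp; exact: (cone_comp m v u). Qed.

Program Definition ev_cone_inv (X : D) (m : PseudoCone (G' c) X) : PseudoCone (G c) X :=
  @mk_cone _ _ (G c) X (fun i => m i) (fun i j u => pn1 m u) _ _ _ _.
Next Obligation. exact: (pn1_iso m). Qed.
Next Obligation. exact: (cone_nat m a). Qed.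
Next Obligation. by rewrite -ev_inclusion_id; exact: (cone_id m i). Qed.
Next Obligation. by rewrite -ev_inclusion_comp; exact: (cone_comp m v u). Qed.

(** In the elementary form the two universal properties differ only in the cones quantified over by
    the existence clause, and [ev_cone_inv] converts those. *)
Lemma ev_cone_pseudocolimit (X : D) (l : PseudoCone (G c) X) :
  is_pseudocolimit l -> is_pseudocolimit (ev_cone l).
Proof.
move=> /pseudocolimitP Hl; apply/pseudocolimitP => Y; have [sur inj full faith] := Hl Y.
split=> // m; exact: (sur (ev_cone_inv m)).
Qed.
End Cones.

(** The cone obtained in [Hom_p] for the composite with the inclusion has 2-natural components, so
    it lifts; the reflection of 2-naturality is precisely the closure condition of
    [lift_cone_pseudocolimit]. *)
Theorem hom_pseudocolimit (L0 : C -> D) (l : forall c : C, PseudoCone (G c) (L0 c)) :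
  (forall c, is_pseudocolimit (l c)) ->
  exists (L1 : TwoFunctorOn L0) (lam : PseudoCone F (Build_TwoFunctor L1 : Hom C D)),
    [/\ forall i, is_2natural (proj1_sig (lam i)),
        forall c, image_cone (ev D c) lam = l c
      & is_pseudocolimit lam].
Proof.
move=> Hl.
have [L1 [lam [lam_nat lam_ev Hlam refl]]] :=
  homp_pseudocolimit (fun c => ev_cone_pseudocolimit (Hl c)).
exists L1, (lift_cone (l := lam) lam_nat); split.
- exact: lam_nat.
- move=> c; have e := lam_ev c; apply: PseudoNat_cell_ext => [i|i j u].
  + have e0 := f_equal (fun s : PseudoNat (G' c) _ => pn0 s i) e.
    have e1 : pn0 (lam i : PseudoNat _ _) c = l c i := e0.
    exact e1.
  + have e0 := f_equal (fun s : PseudoNat _ _ => ⌈pn1 s u⌉) e.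
    rewrite image_cone_cell; rewrite image_cone_cell in e0.
    refine (etrans (ev_fmor _ _) _).
    exact: etrans erefl (etrans (esym (ev_p_fmor _ _)) e0).
- apply: lift_cone_pseudocolimit => // M h; exact: refl.
Qed.
End HomCase.

(** * Pseudo-limits described by 1-cells and 2-cells alone *)

Section ElementaryLimits.
Context {I B : TwoCat} (G : PseudoFunctor I B).

Program Definition mk_dual_cone (X : B) (m0 : forall i, hom X (G i))
    (m1 : forall i j (u : hom i j), mor (pf1 G u ∘ m0 i) (m0 j ∘ id1 X))
    (m1_iso : forall i j (u : hom i j), is_iso (m1 i j u))
    (m1_nat : forall i j (u u' : hom i j) (a : mor u u'),
      ⌈m1 i j u'⌉ ⊙ rw (m0 i) ⌈fmor (pf1 G) a⌉ = ⌈m1 i j u⌉)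
    (m1_id : forall i, ⌈m1 i i (id1 i)⌉ ⊙ rw (m0 i) ⌈pf_id G i⌉ = ⌈idm (m0 i)⌉)
    (m1_comp : forall i j k (v : hom j k) (u : hom i j),
      ⌈m1 i k (v ∘ u)⌉ ⊙ rw (m0 i) ⌈pf_comp G v u⌉
      = ⌈m1 j k v⌉ ⊙ lw (pf1 G v) ⌈m1 i j u⌉) :
    DualPseudoCone G X :=
  {| pn0 := m0; pn1 := m1 |}.
Next Obligation. exact: m1_iso. Qed.
Next Obligation. apply: cell_inj; rewrite /=; cells; exact: m1_nat. Qed.
Next Obligation. by apply: cell_inj; rewrite /=; cells; rewrite comp1l; exact: m1_id. Qed.
Next Obligation. apply: cell_inj; rewrite /=; cells; exact: m1_comp. Qed.

Definition dual_compatible (X Y : B) (l : DualPseudoCone G X) (h h' : hom Y X)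
    (r : forall i, mor (l i ∘ h) (l i ∘ h')) : Prop :=
  forall i j (u : hom i j),
    rw h' ⌈pn1 l u⌉ ⊙ lw (pf1 G u) ⌈r i⌉ = ⌈r j⌉ ⊙ rw h ⌈pn1 l u⌉.

Program Definition mk_postcomp_modification (X Y : B) (l : DualPseudoCone G X)
    (h h' : hom Y X) (r : forall i, mor (l i ∘ h) (l i ∘ h')) (Hr : dual_compatible r) :
    Modification (postcomp_cone l Y h) (postcomp_cone l Y h') :=
  {| md := r |}.
Next Obligation.
apply: cell_inj; rewrite [LHS]cell_comp [RHS]cell_comp !comp_const_cell cell_rw rw_id.
exact: Hr.
Qed.

Lemma pseudolimitP (X : B) (l : DualPseudoCone G X) :
  is_pseudolimit l <-> forall Y : B,
  [/\ forall m : DualPseudoCone G Y, exists h : hom Y X,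
        (forall i, l i ∘ h = m i) /\
        forall i j (u : hom i j), rw h ⌈pn1 l u⌉ = ⌈pn1 m u⌉,
      forall h h' : hom Y X, (forall i, l i ∘ h = l i ∘ h') ->
        (forall i j (u : hom i j), rw h ⌈pn1 l u⌉ = rw h' ⌈pn1 l u⌉) -> h = h',
      forall (h h' : hom Y X) (r : forall i, mor (l i ∘ h) (l i ∘ h')),
        dual_compatible r -> exists a : mor h h', forall i, l i ◁ a = r i
    & forall (h h' : hom Y X) (a b : mor h h'), (forall i, l i ◁ a = l i ◁ b) -> a = b].
Proof.
split=> H Y.
- have /cat_isomorphismP [sur inj full faith] := H Y; split.
  + move=> m; have [h e] := sur m; exists h.
    split=> [i|i j u]; last by rewrite -comp_const_cell -e.
    exact: (f_equal (fun m : DualPseudoCone G Y => m i) e).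
  + move=> h h' e0 e1; apply: inj; apply: PseudoNat_cell_ext => // i j u.
    by rewrite !comp_const_cell.
  + move=> h h' r Hr; have [a e] := full h h' (mk_postcomp_modification Hr); exists a => i.
    exact: (f_equal (fun r : Modification _ _ => r i) e).
  + move=> h h' a b e; apply: faith; apply: Modification_ext; exact: e.
- have [ex un full faith] := H Y; apply/cat_isomorphismP; split.
  + move=> m; have [h [h0 h1]] := ex m; exists h.
    by apply: PseudoNat_cell_ext => // i j u; rewrite comp_const_cell.
  + move=> h h' e; apply: un => [i|i j u]; last first.
      rewrite -!comp_const_cell.
      exact: (f_equal (fun m : DualPseudoCone G Y => ⌈pn1 m u⌉) e).
    exact: (f_equal (fun m : DualPseudoCone G Y => m i) e).
  + move=> h h' r; have [|a ar] := full h h' (fun i => md r i).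
      by move=> i j u; have := md_nat_cell r u; rewrite !comp_const_cell rw_id.
    by exists a; apply: Modification_ext => i /=.
  + move=> h h' a b e; apply: faith => i.
    exact: (f_equal (fun r : Modification _ _ => r i) e).
Qed.
End ElementaryLimits.

(** * Pseudo-limits in a locally full sub-2-category *)

Section DualLift.
Context {B : TwoCat} (P : forall x y : B, hom x y -> Prop) (P_id : forall x, @P x x (id1 x))
  (P_comp : forall x y z (g : hom y z) (f : hom x y),
    @P y z g -> @P x y f -> @P x z (g ∘ f)).
Let BP := locally_full_sub2category P_id P_comp.
Context {I : TwoCat} (F : PseudoFunctor I BP).
Local Notation F' := (comp_2functor (inclusion P_id P_comp) F).
Context (X : B) (l : DualPseudoCone F' X) (Pl : forall i, P (l i)).

Let lift0 (i : I) : hom (X : BP) (F i) := exist _ (l i) (Pl i).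
Let lift1 (i j : I) (u : hom i j) : mor (pf1 F u ∘ lift0 i) (lift0 j ∘ id1 (X : BP)) :=
  pn1 l u.

Program Definition lift_dual_cone : DualPseudoCone F (X : BP) :=
  @mk_dual_cone _ _ F X lift0 lift1 _ _ _ _.
Next Obligation. exact (pn1_iso l u). Qed.
Next Obligation.
apply: forget_cell_inj; rewrite forget_cell_vcomp forget_cell_rw.
exact: (dual_cone_nat l a).
Qed.
Next Obligation.
apply: forget_cell_inj; rewrite forget_cell_vcomp forget_cell_rw.
by apply: etrans (dual_cone_id l i); rewrite comp_2functor_id_cell.
Qed.
Next Obligation.
apply: forget_cell_inj; rewrite !forget_cell_vcomp forget_cell_lw forget_cell_rw.
by apply: etrans (dual_cone_comp l v u); rewrite comp_2functor_comp_cell.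
Qed.

(** Membership in [P] of a mediating 1-cell is now detected by composing the projections after
    it. *)
Lemma lift_dual_cone_pseudolimit :
  is_pseudolimit l ->
  (forall Y (h : hom Y X), (forall i, P (l i ∘ h)) -> P h) ->
  is_pseudolimit lift_dual_cone.
Proof.
move=> /pseudolimitP Hl HP; apply/pseudolimitP => Y; have [sur inj full faith] := Hl Y.
split.
- move=> m; have [h [h0 h1]] := sur (image_dual_cone (inclusion P_id P_comp) m).
  have Ph : P h by apply: HP => i; rewrite h0; exact: proj2_sig (m i).
  exists (exist _ h Ph); split=> [i|i j u]; first exact/full_subcategory_eq/h0.
  apply: forget_cell_inj; rewrite forget_cell_rw; apply: etrans (h1 i j u) _.
  exact (image_dual_cone_cell (inclusion P_id P_comp) m u).
- move=> h h' e0 e1; apply: full_subcategory_eq; apply: inj => [i|i j u].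
  + exact: (f_equal (@proj1_sig _ _) (e0 i)).
  + have := f_equal (@forget_cell _ _) (e1 i j u); by rewrite !forget_cell_rw.
- move=> h h' r Hr; have [|a ar] := full (proj1_sig h) (proj1_sig h') r; last by exists a.
  move=> i j u; have := f_equal (@forget_cell _ _) (Hr i j u).
  by rewrite !forget_cell_vcomp !forget_cell_rw forget_cell_lw.
- by move=> h h' a b; exact (faith (proj1_sig h) (proj1_sig h') a b).
Qed.
End DualLift.

(** * Pseudo-limits in [Hom] *)

Section HomDualCase.
Context {C D I : TwoCat} (F : PseudoFunctor I (Hom C D)).
Local Notation F' := (comp_2functor (@hom_inclusion C D) F).
Local Notation G c := (comp_2functor (ev D c) F).
Local Notation G' c := (comp_2functor (ev_p D c) F').

Section DualCones.
Context (c : C).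

Program Definition ev_dual_cone (X : D) (m : DualPseudoCone (G c) X) :
    DualPseudoCone (G' c) X :=
  @mk_dual_cone _ _ (G' c) X (fun i => m i) (fun i j u => pn1 m u) _ _ _ _.
Next Obligation. exact: (pn1_iso m). Qed.
Next Obligation. exact: (dual_cone_nat m a). Qed.
Next Obligation. by rewrite ev_inclusion_id; exact: (dual_cone_id m i). Qed.
Next Obligation. by rewrite ev_inclusion_comp; exact: (dual_cone_comp m v u). Qed.

Program Definition ev_dual_cone_inv (X : D) (m : DualPseudoCone (G' c) X) :
    DualPseudoCone (G c) X :=
  @mk_dual_cone _ _ (G c) X (fun i => m i) (fun i j u => pn1 m u) _ _ _ _.
Next Obligation. exact: (pn1_iso m). Qed.
Next Obligation. exact: (dual_cone_nat m a). Qed.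
Next Obligation. by rewrite -ev_inclusion_id; exact: (dual_cone_id m i). Qed.
Next Obligation. by rewrite -ev_inclusion_comp; exact: (dual_cone_comp m v u). Qed.

Lemma ev_dual_cone_pseudolimit (X : D) (l : DualPseudoCone (G c) X) :
  is_pseudolimit l -> is_pseudolimit (ev_dual_cone l).
Proof.
move=> /pseudolimitP Hl; apply/pseudolimitP => Y; have [sur inj full faith] := Hl Y.
split=> // m; exact: (sur (ev_dual_cone_inv m)).
Qed.
End DualCones.

Theorem hom_pseudolimit (L0 : C -> D) (l : forall c : C, DualPseudoCone (G c) (L0 c)) :
  (forall c, is_pseudolimit (l c)) ->
  exists (L1 : TwoFunctorOn L0) (lam : DualPseudoCone F (Build_TwoFunctor L1 : Hom C D)),
    [/\ forall i, is_2natural (proj1_sig (lam i)),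
        forall c, image_dual_cone (ev D c) lam = l c
      & is_pseudolimit lam].
Proof.
move=> Hl.
have [L1 [lam [lam_nat lam_ev Hlam refl]]] :=
  homp_pseudolimit (fun c => ev_dual_cone_pseudolimit (Hl c)).
exists L1, (lift_dual_cone (l := lam) lam_nat); split.
- exact: lam_nat.
- move=> c; have e := lam_ev c; apply: PseudoNat_cell_ext => [i|i j u].
  + have e0 := f_equal (fun s : PseudoNat _ (G' c) => pn0 s i) e.
    have e1 : pn0 (lam i : PseudoNat _ _) c = l c i := e0.
    exact e1.
  + have e0 := f_equal (fun s : PseudoNat _ _ => ⌈pn1 s u⌉) e.
    have e1 := etrans (esym (ev_dual_cone_cell (M := Build_TwoFunctor L1) lam u c)) e0.
    rewrite image_dual_cone_cell.
    refine (etrans (ev_fmor _ _) _).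
    refine (etrans _ e1); reflexivity.
- apply: lift_dual_cone_pseudolimit => // M h; exact: refl.
Qed.
End HomDualCase.

Theorem proposition1p2p7 (C D I : TwoCat) :
  (* A = Hom C D, pseudo-colimits *)
  (forall (F : PseudoFunctor I (Hom C D)) (L0 : C -> D)
      (l : forall c : C, PseudoCone (comp_2functor (ev D c) F) (L0 c)),
    (forall c : C, is_pseudocolimit (l c)) ->
    exists L1 : TwoFunctorOn L0,
    let L : Hom C D := Build_TwoFunctor L1 in
    exists lam : PseudoCone F L,
      (forall i : I, is_2natural (proj1_sig (lam i))) /\
      (forall c : C, image_cone (ev D c) lam = l c) /\
      is_pseudocolimit lam)
  /\
  (* A = Hom_p C D, pseudo-colimits *)
  (forall (F : PseudoFunctor I (Hom_p C D)) (L0 : C -> D)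
      (l : forall c : C, PseudoCone (comp_2functor (ev_p D c) F) (L0 c)),
    (forall c : C, is_pseudocolimit (l c)) ->
    exists L1 : TwoFunctorOn L0,
    let L : Hom_p C D := Build_TwoFunctor L1 in
    exists lam : PseudoCone F L,
      (forall i : I, is_2natural (lam i)) /\
      (forall c : C, image_cone (ev_p D c) lam = l c) /\
      is_pseudocolimit lam)
  /\
  (* A = Hom C D, pseudo-limits *)
  (forall (F : PseudoFunctor I (Hom C D)) (L0 : C -> D)
      (l : forall c : C, DualPseudoCone (comp_2functor (ev D c) F) (L0 c)),
    (forall c : C, is_pseudolimit (l c)) ->
    exists L1 : TwoFunctorOn L0,
    let L : Hom C D := Build_TwoFunctor L1 in
    exists lam : DualPseudoCone F L,
      (forall i : I, is_2natural (proj1_sig (lam i))) /\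
      (forall c : C, image_dual_cone (ev D c) lam = l c) /\
      is_pseudolimit lam)
  /\
  (* A = Hom_p C D, pseudo-limits *)
  (forall (F : PseudoFunctor I (Hom_p C D)) (L0 : C -> D)
      (l : forall c : C, DualPseudoCone (comp_2functor (ev_p D c) F) (L0 c)),
    (forall c : C, is_pseudolimit (l c)) ->
    exists L1 : TwoFunctorOn L0,
    let L : Hom_p C D := Build_TwoFunctor L1 in
    exists lam : DualPseudoCone F L,
      (forall i : I, is_2natural (lam i)) /\
      (forall c : C, image_dual_cone (ev_p D c) lam = l c) /\
      is_pseudolimit lam).
Proof.
split; [|split; [|split]] => F L0 l Hl.
- by have [L1 [lam [nat_lam ev_lam Hlam]]] := hom_pseudocolimit Hl; exists L1; exists lam.
- by have [L1 [lam [nat_lam ev_lam Hlam _]]] := homp_pseudocolimit Hl; exists L1; exists lam.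
- by have [L1 [lam [nat_lam ev_lam Hlam]]] := hom_pseudolimit Hl; exists L1; exists lam.
- by have [L1 [lam [nat_lam ev_lam Hlam _]]] := homp_pseudolimit Hl; exists L1; exists lam.
Qed.
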